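(* Let $1\le p<\infty$. If $A\in(l_p(r,s,t;B),c)$, then $$\frac12\limsup_{n\to\infty}\big\|(\tilde a_{nk}-\tilde\alpha_k)_{k}\big\|_{l_{p'}}\le\|L_A\|_\chi\le\limsup_{n\to\infty}\big\|(\tilde a_{nk}-\tilde\alpha_k)_{k}\big\|_{l_{p'}},$$ where $\tilde\alpha_k=\lim_{n\to\infty}\tilde a_{nk}$ for all $k$. (For $1<p<\infty$ the norm is $\big(\sum_{k=0}^\infty|\tilde a_{nk}-\tilde\alpha_k|^{p'}\big)^{1/p'}$.)
   Context: Sequences are indexed by $\mathbb{N}_0=\{0,1,2,\dots\}$; $w$ is the space of all real or complex sequences. $r=(r_n)$, $t=(t_n)$, $s=(s_n)$ are sequences in $w$ with $r_n\ne0$, $t_n\neq 0$ for all $n$, and $s_0\neq0$; $u,v$ are nonzero scalars. $A(r,s,t)$ is the lower triangular infinite matrix with entries $s_{n-k}t_k/r_n$ for $0\le k\le n$ and $0$ for $k>n$; $B=B(u,v)=(b_{nk})$ has $b_{nn}=u$, $b_{n,n-1}=v$ and all other entries $0$. For real $p\ge1$, $l_p(r,s,t;B)=\{x\in w:(A(r,s,t)\cdot B)x\in l_p\}$ with norm $\|x\|=\|(A(r,s,t)\cdot B)x\|_{l_p}$ (a $BK$ space, i.e. a Banach sequence space with continuous coordinates). $p'=p/(p-1)$ for $p>1$ and $p'=\infty$ for $p=1$. The space $c$ of convergent sequences carries the sup norm. $D^{(s)}_0=1/s_0$ and, for $n\ge1$, $D^{(s)}_n=s_0^{-(n+1)}\det(d_{ij})_{1\le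 i,j\le n}$ with $d_{ij}=s_{i-j+1}$ if $j\le i+1$ and $d_{ij}=0$ if $j>i+1$. For sequence spaces $U,V$, $(U,V)$ is the class of infinite matrices $A=(a_{nk})$ such that for all $x\in U$ the series $(Ax)_n=\sum_ka_{nk}x_k$ converge and $Ax\in V$. $L_A$ is the operator $L_A(x)=Ax$ (bounded when $U,V$ are $BK$ spaces with $U$ containing all finite sequences). For a matrix $A=(a_{nk})$, $$\tilde a_{nk}=r_k\Big[\frac{a_{nk}}{s_0t_k}\frac1u+\sum_{i=k}^{k+1}(-1)^{i-k}\frac{D^{(s)}_{i-k}}{t_i}\Big(\sum_{j=k+1}^\infty\frac{(-v)^{j-i}}{u^{j-i+1}}a_{nj}\Big)+\sum_{i=k+2}^\infty(-1)^{i-k}\frac{D^{(s)}_{i-k}}{t_i}\Big(\sum_{j=i}^\infty\frac{(-v)^{j-i}}{u^{j-i+1}}a_{nj}\Big)\Big],$$ provided the series converge. The Hausdorff measure of noncompactness of a bounded subset $Q$ of a metric space $X$ is $\chi(Q)=\inf\{\epsilon>0: Q\subset\bigcup_{i=0}^nB(x_i,r_i),\ x_i\in X,\ r_i<\epsilon,\ n\in\mathbb{N}_0\}$, where $B(x_i,r_i)$ are open balls. For a bounded operator $L:X\to Y$ between Banach spaces, $\|L\|_\chi=\chi(L(S_X))$ with $S_X$ the unit sphere of $X$.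
   Formalization: The formal theorem assumes that the limits α̃_k exist and that each sequence (ã_nk − α̃_k)_k lies in l_{p'}; convergence of the series for ã_nk and A ∈ (l_p(r,s,t;B), c) alone do not guarantee this, since the limits can fail to exist. *)

(* Defs.v *)
From HB Require Import structures.
From mathcomp Require Import all_boot all_order all_algebra.
From mathcomp Require Import complex.
From mathcomp Require Import all_classical all_reals all_analysis.

Set Implicit Arguments.
Unset Strict Implicit.
Unset Printing Implicit Defensive.

Import Order.TTheory GRing.Theory Num.Theory.
Import numFieldNormedType.Exports.

Local Open Scope classical_set_scope.
Local Open Scope ring_scope.

(* The scalars are the reals or the complex numbers.  The norm of [R[i]] takes
   its values in [R[i]], so the modulus is carried as an [R]-valued function. *)
Variant scalar_field (R : realType) :
    forall K : numFieldType, (K -> R) -> Prop :=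
| real_scalars : @scalar_field R R (fun x : R => `|x|)
| complex_scalars : @scalar_field R R[i] (fun z : R[i] => complex.Re `|z|).

Section matrices.
Context {K : numFieldType}.

(* The partial sums from [m] on, and the value of the series; the latter is
   meaningful only when the former converge, i.e. under [summable_from]. *)
Definition psum_from (m : nat) (f : nat -> K) : nat -> K :=
  fun N => \sum_(m <= j < N) f j.

Definition summable_from (m : nat) (f : nat -> K) : Prop :=
  cvgn (psum_from m f).

Definition tsum (m : nat) (f : nat -> K) : K := limn (psum_from m f).

Definition inf_matrix := nat -> nat -> K.

Definition mx_apply (A : inf_matrix) (x : nat -> K) : nat -> K :=
  fun n => tsum 0 (fun k => A n k * x k).

Definition mx_mul (A B : inf_matrix) : inf_matrix :=
  fun n k => tsum 0 (fun j => A n j * B j k).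

Definition mx_class (U V : set (nat -> K)) : set inf_matrix :=
  [set A | forall x, U x ->
     (forall n, summable_from 0 (fun k => A n k * x k)) /\ V (mx_apply A x)].

Definition A_rst (r s t : nat -> K) : inf_matrix :=
  fun n k => if (k <= n)%N then s (n - k)%N * t k / r n else 0.

Definition B_uv (u v : K) : inf_matrix :=
  fun n k => if k == n then u else if k.+1 == n then v else 0.

(* The indices start at 0 here, which leaves [i - j] unchanged. *)
Definition D_s (s : nat -> K) (n : nat) : K :=
  if n is 0%N then (s 0%N)^-1 else
  (s 0%N) ^- n.+1 *
  \det (\matrix_(i < n, j < n)
          (if (j <= i.+1)%N then s (i.+1 - j)%N else 0)).

Section tilde.
Variables (r s t : nat -> K) (u v : K) (A : inf_matrix).

Definition tilde_inner (n i : nat) : nat -> K :=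
  fun j => (- v) ^+ (j - i) / u ^+ (j - i).+1 * A n j.

Definition tilde_outer (n k : nat) : nat -> K :=
  fun i => (- 1) ^+ (i - k) * (D_s s (i - k)%N / t i) *
           tsum i (tilde_inner n i).

Definition tilde : inf_matrix := fun n k =>
  r k * (A n k / (s 0%N * t k) * u^-1
         + \sum_(k <= i < k.+2)
             (- 1) ^+ (i - k) * (D_s s (i - k)%N / t i) *
             tsum k.+1 (tilde_inner n i)
         + tsum k.+2 (tilde_outer n k)).

Definition tilde_defined : Prop := forall n k,
  [/\ forall i, (k <= i < k.+2)%N -> summable_from k.+1 (tilde_inner n i),
      forall i, (k.+2 <= i)%N -> summable_from i (tilde_inner n i) &
      summable_from k.+2 (tilde_outer n k)].

End tilde.

Definition c_space : set (nat -> K) := [set x | cvgn x].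

End matrices.

Arguments inf_matrix K : clear implicits.

Section spaces.
Context {R : realType} {K : numFieldType}.
Variable abs : K -> R.

(* At [p = +oo] this is an essential supremum, which for the counting measure is
   the supremum. *)
Definition lp_norm (p : \bar R) (x : nat -> K) : \bar R :=
  ('N[counting]_p[EFin \o abs \o x])%E.

Definition lp_space (p : \bar R) : set (nat -> K) :=
  [set x | (lp_norm p x < +oo)%E].

Definition sup_norm (x : nat -> K) : \bar R :=
  ereal_sup (range (fun n => (abs (x n))%:E)).

Definition lp_rst_norm (p : R) (r s t : nat -> K) (u v : K) (x : nat -> K) :
    \bar R :=
  lp_norm p%:E (mx_apply (mx_mul (A_rst r s t) (B_uv u v)) x).

Definition lp_rst (p : R) (r s t : nat -> K) (u v : K) : set (nat -> K) :=
  [set x | lp_space p%:E (mx_apply (mx_mul (A_rst r s t) (B_uv u v)) x)].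

End spaces.

Section measure_of_noncompactness.
Context {R : realType}.

(* A metric space is given as a subset [X] of a type with a distance, which
   need only be finite on [X]; the centres of the balls range over [X]. *)
Definition open_ball (T : Type) (X : set T) (d : T -> T -> \bar R)
    (x : T) (rho : R) : set T :=
  [set y | X y /\ (d x y < rho%:E)%E].

Definition hausdorff_mnc (T : Type) (X : set T) (d : T -> T -> \bar R)
    (Q : set T) : \bar R :=
  ereal_inf [set eps%:E | eps in [set eps : R | 0 < eps /\
    exists (n : nat) (x : 'I_n.+1 -> T) (rho : 'I_n.+1 -> R),
      (forall i, X (x i) /\ rho i < eps) /\
      Q `<=` \bigcup_(i in [set: 'I_n.+1]) open_ball X d (x i) (rho i)]].

Definition operator_mnc (K : numFieldType)
    (X : set (nat -> K)) (normX : (nat -> K) -> \bar R)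
    (Y : set (nat -> K)) (normY : (nat -> K) -> \bar R)
    (L : (nat -> K) -> (nat -> K)) : \bar R :=
  hausdorff_mnc Y (fun y z => normY (y \- z))
    (L @` [set x | X x /\ normX x = 1%E]).

End measure_of_noncompactness.

(* Main.v *)
Require Import Defs.
From HB Require Import structures.
From mathcomp Require Import all_boot all_order all_algebra.
From mathcomp Require Import complex.
From mathcomp Require Import all_classical all_reals all_analysis.
From mathcomp Require Import ess_sup_inf.
From mathcomp Require Import ring lra.

(** The triangle [T = A(r,s,t) B(u,v)] has a lower triangular inverse, so a
    matrix [A] on [l_p(r,s,t;B)] is the same as a sequence of functionals
    [G n y = (A T^-1 y)_n] on [l_p]. Each is a pointwise limit of functionals
    with finitely many coefficients ([row_coef]), and [G n y] converges to some
    [l y] as [n] grows. Two uses of the uniform boundedness principle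
    ([uniform_boundedness], by a gliding hump) show that [G n] and [l] are given
    by coefficients [f n] and [a] with bounded dual norms
    ([matrix_factorization]). By duality ([lp_dualP]) the norm of [f n - a] with
    the conjugate exponent is the norm of the functional [G n - l].

    In the space of convergent sequences, the image of the unit sphere consists
    of the sequences [G n y], with limits [l y]. If the norm of [G n - l] is at
    most [e] from some index on, then all these sequences are within [e] of
    being constant from there on, and a finite net for the finitely many earlier
    entries and the limit gives a cover by balls of radius about [e]
    ([hausdorff_mnc_le]). Conversely, if finitely many balls of radius less than
    [e] cover the image, then far enough out every sequence in the image is
    within [2 e] of its limit ([cover_near_limit]), so that the norm of
    [G n - l] is at most [2 e].

    The matrix [tilde] is not quite the matrix of the [f n]: it results from
    interchanging two series that need not converge absolutely. The interchange
    is exact for partial sums up to the product of a factor depending on the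
    column and one depending on the row ([tilde_partial]). The limits of these
    products form a matrix of rank at most one ([cvg_product_rank1]). Hence
    [tilde n k - alpha k] and [f n k - a k] differ by [(lam n - L) mu k] with
    [lam n] tending to [L], and this tends to zero in the dual norm
    ([rank1_dual_cvg0]), so both have the same limit superior. *)

Set Implicit Arguments.
Unset Strict Implicit.
Unset Printing Implicit Defensive.

Import Order.TTheory GRing.Theory Num.Theory.
Import numFieldNormedType.Exports.

Local Open Scope classical_set_scope.
Local Open Scope ring_scope.

(** * The scalars *)

(** The norm of [K] takes its values in [K]; placing the modulus there by [emb]
    treats real and complex scalars at once. *)
Lemma scalar_embedding (R : realType) (K : numFieldType) (abs : K -> R) :
  scalar_field abs -> exists emb : {rmorphism R -> K},
    [/\ {mono emb : a b / a <= b}, forall x, `|x| = emb (abs x) &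
        forall e, 0 < e -> exists2 a, 0 < a & emb a = e].
Proof.
case.
- exists idfun; split=> //.
  by move=> e e0; exists e.
- exists (real_complex R); split=> [a b|x|e].
  + by rewrite lecR.
  + by rewrite normc_def.
  + by case: e => a b; rewrite ltcE /= => /andP[/eqP -> a0]; exists a.
Qed.

Lemma real_totally_bounded (R : realType) (M d : R) : 0 < d ->
  exists s : seq R, forall x, `|x| <= M -> exists2 c, c \in s & `|x - c| <= d.
Proof.
move=> d0.
pose s := [seq d * i%:R - M | i <- iota 0 (Num.truncn (2 * M / d)).+1].
exists s => x xM.
have /andP[xM1 xM2] : - M <= x <= M by rewrite -ler_norml.
have h0 : 0 <= (x + M) / d by apply: divr_ge0; [lra|exact: ltW].
exists (d * (Num.truncn ((x + M) / d))%:R - M).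
  apply: (map_f (fun i : nat => d * i%:R - M)); rewrite mem_iota /= add0n ltnS.
  by apply: le_truncn; rewrite ler_pM2r ?invr_gt0//; lra.
have := truncn_itv h0; rewrite ler_pdivlMr// ltr_pdivrMr//.
set N := Num.truncn _; rewrite -natr1 mulrDl mul1r => /andP[h1 h2].
rewrite ler_norml; apply/andP; split; rewrite [d * _]mulrC; lra.
Qed.

Section scalars.
Context {R : realType} {K : numFieldType} {abs : K -> R}.
Hypothesis hK : scalar_field abs.

Lemma abs_embedding : exists emb : {rmorphism R -> K},
  [/\ forall x, `|x| = emb (abs x), forall a, abs (emb a) = `|a| &
      forall e, 0 < e -> exists2 a, 0 < a & emb a = e].
Proof.
have [emb [embM embN embS]] := scalar_embedding hK.
exists emb; split=> // a; apply: (inc_inj embM); rewrite -embN.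
have emb0 b : 0 <= b -> 0 <= emb b by rewrite -[0 in X in _ -> X](rmorph0 emb) embM.
have [a0|a0] := leP 0 a; first by rewrite ger0_norm ?emb0// ger0_norm.
rewrite (ler0_norm (ltW a0)) -[a]opprK rmorphN normrN ger0_norm ?opprK//.
by rewrite emb0// oppr_ge0 ltW.
Qed.

Lemma abs_norm_mono x y : (abs x <= abs y) = (`|x| <= `|y|).
Proof. by have [emb [embM embN _]] := scalar_embedding hK; rewrite !embN embM. Qed.

Lemma abs_ge0 x : 0 <= abs x.
Proof.
have [emb [embM embN _]] := scalar_embedding hK.
by rewrite -embM rmorph0 -embN.
Qed.

Lemma absM x y : abs (x * y) = abs x * abs y.
Proof.
have [emb [embM embN _]] := scalar_embedding hK.
by apply: (inc_inj embM); rewrite rmorphM -!embN normrM.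
Qed.

Lemma abs_triangle x y : abs (x + y) <= abs x + abs y.
Proof.
have [emb [embM embN _]] := scalar_embedding hK.
by rewrite -embM rmorphD -!embN ler_normD.
Qed.

Lemma abs0 : abs 0 = 0.
Proof.
have [emb [embM embN _]] := scalar_embedding hK.
by apply: (inc_inj embM); rewrite rmorph0 -embN normr0.
Qed.

Lemma abs1 : abs 1 = 1.
Proof.
have [emb [embM embN _]] := scalar_embedding hK.
by apply: (inc_inj embM); rewrite rmorph1 -embN normr1.
Qed.

Lemma abs_eq0 x : (abs x == 0) = (x == 0).
Proof.
have [emb [embM embN _]] := scalar_embedding hK.
by rewrite -(inj_eq (inc_inj embM)) rmorph0 -embN normr_eq0.
Qed.

Lemma absN x : abs (- x) = abs x.
Proof. by apply/eqP; rewrite eq_le !abs_norm_mono normrN lexx. Qed.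

Lemma abs_dist x y : abs (x - y) = abs (y - x).
Proof. by rewrite -absN opprB. Qed.

Lemma abs_sub_triangle z x y : abs (x - y) <= abs (x - z) + abs (z - y).
Proof. by rewrite (le_trans _ (abs_triangle _ _))// addrA subrK. Qed.

Lemma abs_le_sub x y : abs x <= abs (x - y) + abs y.
Proof. by rewrite (le_trans _ (abs_triangle _ _))// subrK. Qed.

Lemma abs_sum (I : Type) (s : seq I) (P : pred I) (F : I -> K) :
  abs (\sum_(i <- s | P i) F i) <= \sum_(i <- s | P i) abs (F i).
Proof.
elim/big_ind2: _ => [|x a y b hx hy|//]; first by rewrite abs0.
exact: le_trans (abs_triangle _ _) (lerD hx hy).
Qed.

Lemma abs_cvgP (f : nat -> K) (l : K) :
  f @ \oo --> l <-> forall e, 0 < e -> \forall n \near \oo, abs (f n - l) <= e.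
Proof.
have [emb [embM embN embS]] := scalar_embedding hK.
split=> [/cvgrPdist_le fl e e0|fl].
  have e0' : 0 < emb e by rewrite -(rmorph0 emb) (leW_mono embM).
  by apply: filterS (fl _ e0') => n; rewrite embN embM abs_dist.
apply/cvgrPdist_le => e /embS[a a0 <-].
by apply: filterS (fl a a0) => n; rewrite embN embM abs_dist.
Qed.

Lemma abs_cvg_le (f : nat -> K) (l c : K) (B : R) :
  f @ \oo --> l -> (\forall n \near \oo, abs (f n - c) <= B) -> abs (l - c) <= B.
Proof.
move=> /abs_cvgP fl fB; apply/ler_addgt0Pr => e e0.
have [n [h1 h2]] := filter_ex (filterI fB (fl e e0)).
by rewrite (le_trans (abs_sub_triangle (f n) _ _))// addrC lerD// abs_dist.
Qed.

Lemma abs_cvg_bounded (f : nat -> K) : cvgn f -> exists B, forall n, abs (f n) <= B.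
Proof.
move=> fl; set l := limn f in fl; have /abs_cvgP/(_ 1 ltr01)[N _ fN] := fl.
exists (\sum_(0 <= i < N) abs (f i) + (1 + abs l)) => n.
have s0 : 0 <= \sum_(0 <= i < N) abs (f i) by apply: sumr_ge0 => i _; exact: abs_ge0.
have [Nn|nN] := leqP N n.
  rewrite (le_trans (abs_le_sub (f n) l))// (le_trans (lerD (fN n Nn) (lexx _)))//.
  by rewrite lerDr.
rewrite (@le_trans _ _ (\sum_(0 <= i < N) abs (f i)))//; last first.
  by rewrite lerDl addr_ge0// abs_ge0.
rewrite (bigD1_seq n) ?mem_index_iota ?iota_uniq//= lerDl.
by apply: sumr_ge0 => i _; exact: abs_ge0.
Qed.

Lemma totally_bounded (M d : R) : 0 < d ->
  exists s : seq K, forall x, abs x <= M -> exists2 c, c \in s & abs (x - c) <= d.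
Proof.
case: hK M d => [|] M d d0; first exact: real_totally_bounded.
have [s hs] := @real_totally_bounded R M (d / 2) (divr_gt0 d0 (ltr0n _ 2)).
exists [seq (a +i* b)%C | a <- s, b <- s] => -[x y].
rewrite normc_def /= => xyM.
have xM : `|x| <= M.
  apply: le_trans xyM; rewrite -sqrtr_sqr ler_wsqrtr// lerDl; exact: sqr_ge0.
have yM : `|y| <= M.
  apply: le_trans xyM; rewrite -sqrtr_sqr ler_wsqrtr// lerDr; exact: sqr_ge0.
have [a sa xa] := hs _ xM; have [b sb yb] := hs _ yM.
exists (a +i* b)%C; first exact: allpairs_f.
change (complex.Re `|(x +i* y)%C - (a +i* b)%C| <= d).
rewrite normc_def /= -(@ger0_norm _ d (ltW d0)) -sqrtr_sqr ler_wsqrtr//.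
rewrite -[X in X + _]real_normK ?num_real// -[X in _ + X]real_normK ?num_real//.
have := normr_ge0 (x - a); have := normr_ge0 (y - b); nra.
Qed.

End scalars.

(** * The norm of l_p and its dual norm *)

Lemma lee_nneseriesP (R : realType) (f : nat -> R) (B : R) :
  (forall k, 0 <= f k) ->
  ((\sum_(k <oo) (f k)%:E <= B%:E)%E <-> forall m, \sum_(0 <= k < m) f k <= B).
Proof.
move=> f0; have f0' n : (0 <= (f n)%:E)%E by rewrite lee_fin.
split=> [fB m|fB].
  rewrite -lee_fin -sumEFin (le_trans _ fB)//.
  exact: nneseries_lim_ge.
apply: lime_le; first exact: is_cvg_nneseries.
by apply: nearW => m; rewrite sumEFin lee_fin.
Qed.

Lemma counting_eq0 (T : choiceType) (R : realType) (X : set T) :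
  counting X = 0%E :> \bar R -> X = set0.
Proof.
rewrite /counting; case: asboolP => // finX [] /eqP.
rewrite pnatr_eq0 finmap.cardfs_eq0 => /eqP h.
by rewrite -(fset_setK finX) h set_fset0.
Qed.

Section sequence_norms.
Context {R : realType} {K : numFieldType} {abs : K -> R}.
Hypothesis hK : scalar_field abs.

Lemma lp_norm_ge0 (p : \bar R) y : (0 <= lp_norm abs p y)%E.
Proof. exact: Lnorm_ge0. Qed.

Lemma lp_normE (p : R) y : 0 < p ->
  lp_norm abs p%:E y = ((\sum_(k <oo) (abs (y k) `^ p)%:E) `^ p^-1)%E.
Proof.
move=> p0; rewrite /lp_norm Lnorm_counting//; congr (_ `^ _)%E.
by apply: eq_eseriesr => k _ /=; rewrite ger0_norm ?(abs_ge0 hK).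
Qed.

Lemma lp_norm_leP (p : R) y (C : R) : 0 < p -> 0 <= C ->
  ((lp_norm abs p%:E y <= C%:E)%E <->
   forall m, \sum_(0 <= k < m) abs (y k) `^ p <= C `^ p).
Proof.
move=> p0 C0; rewrite lp_normE//.
rewrite -lee_nneseriesP; last by move=> k; exact: powR_ge0.
have S0 : (0 <= \sum_(k <oo) (abs (y k) `^ p)%:E)%E.
  by apply: nneseries_ge0 => k _ _; rewrite lee_fin powR_ge0.
have pow (a b : \bar R) (r : R) : (0 <= r)%R -> ( 0 <= a -> a <= b -> a `^ r <= b `^ r)%E.
  move=> r0 a0 ab; apply: gt0_ler_poweR => //; rewrite in_itv/= leey andbT//.
  exact: le_trans ab.
split=> h.
- have : ((\sum_(k <oo) (abs (y k) `^ p)%:E) `^ p^-1 `^ p <= C%:E `^ p)%E.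
    by apply: pow => //; [exact: ltW|exact: poweR_ge0].
  by rewrite -poweRrM mulVf ?gt_eqF// poweRe1// poweR_EFin.
- have : ((\sum_(k <oo) (abs (y k) `^ p)%:E) `^ p^-1 <= (C `^ p)%:E `^ p^-1)%E.
    by apply: pow => //; rewrite invr_ge0 ltW.
  by rewrite poweR_EFin -powRrM mulfV ?gt_eqF// powRr1.
Qed.

Lemma lp_norm_infty_leP y (C : R) :
  (lp_norm abs +oo y <= C%:E)%E <-> forall k, abs (y k) <= C.
Proof.
rewrite /lp_norm unlock /=.
have -> : (0 < @counting nat R [set: nat])%E.
  rewrite lt_neqAle measure_ge0 andbT eq_sym; apply/eqP => /counting_eq0.
  by move=> /seteqP[/(_ 0%N I)].
split=> [/ess_supP [N [_ /counting_eq0 ->]] h k|h].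
  rewrite -lee_fin -[X in X%:E](ger0_norm (abs_ge0 hK _)).
  by apply: contrapT => /h.
by apply/ess_supP; apply: nearW => k /=; rewrite lee_fin ger0_norm ?(abs_ge0 hK).
Qed.

(** Only finitely supported vectors are tested, so that no series has to
    converge. *)
Definition dual_le (p : R) (f : nat -> K) (C : R) : Prop := forall m y,
  \sum_(0 <= k < m) abs (y k) `^ p <= 1 ->
  abs (\sum_(0 <= k < m) f k * y k) <= C.

Lemma single_sum (V : nmodType) (F : nat -> V) i m : (i < m)%N ->
  (forall k, k != i -> F k = 0) -> \sum_(0 <= k < m) F k = F i.
Proof.
move=> im F0; rewrite (bigD1_seq i) ?mem_index_iota ?iota_uniq//= big1 ?addr0//.
Qed.

Lemma dual1_infty f (C : R) : 0 <= C ->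
  (lp_norm abs +oo f <= C%:E)%E <-> dual_le 1 f C.
Proof.
move=> C0; rewrite lp_norm_infty_leP; split=> [fC m y|fC k].
  under eq_bigr do rewrite powRr1 ?(abs_ge0 hK)//.
  move=> y1; apply: le_trans (abs_sum hK _ _ _) _.
  apply: (@le_trans _ _ (C * \sum_(0 <= k < m) abs (y k))); last by rewrite ler_piMr.
  rewrite mulr_sumr; apply: ler_sum => k _; rewrite (absM hK) ler_wpM2r//.
  exact: abs_ge0.
have := fC k.+1 (fun j => (j == k)%:R).
rewrite !(@single_sum _ _ k)// ?eqxx ?mulr1 ?(abs1 hK) ?powR1; first exact.
  by move=> j /negbTE ->; rewrite mulr0.
by move=> j /negbTE ->; rewrite (abs0 hK) powR0 ?oner_eq0.
Qed.

(** Young's inequality gives one direction; in the other, equality holds in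
    Hoelder's inequality at the multiple of [|f|^(q-1)] turned to the phase of
    the conjugate of [f]. *)
Lemma dual_conjugate (p q : R) f (C : R) : 1 < p -> 0 < q -> p^-1 + q^-1 = 1 ->
  0 <= C -> (lp_norm abs q%:E f <= C%:E)%E <-> dual_le p f C.
Proof.
move=> p1 q0 pq C0.
have p0 : 0 < p by lra.
have a0 := abs_ge0 hK.
have pN0 : p != 0 by rewrite gt_eqF.
have qN0 : q != 0 by rewrite gt_eqF.
rewrite lp_norm_leP//; split=> [fC m y y1|fC m].
- apply: le_trans (abs_sum hK _ _ _) _.
  have := C0; rewrite le_eqVlt => /predU1P[C00|Cgt0].
    rewrite big_nat big1// => k km.
    have f0 : \sum_(0 <= k < m) abs (f k) `^ q = 0.
      apply/eqP; rewrite eq_le sumr_ge0 ?andbT; last by move=> *; exact: powR_ge0.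
      by rewrite (le_trans (fC m))// -C00 powR0.
    have : abs (f k) `^ q == 0.
      move/eqP: f0; rewrite psumr_eq0; last by move=> *; exact: powR_ge0.
      by move/allP => /(_ k); rewrite mem_index_iota; apply.
    by rewrite powR_eq0 (abs_eq0 hK) qN0 andbT => /eqP ->; rewrite mul0r (abs0 hK).
  have -> : \sum_(0 <= k < m) abs (f k * y k) =
      C * \sum_(0 <= k < m) abs (y k) * (abs (f k) / C).
    rewrite mulr_sumr; apply: eq_bigr => k _; rewrite (absM hK).
    by field; rewrite gt_eqF.
  rewrite ler_piMr//.
  apply: (@le_trans _ _ (\sum_(0 <= k < m)
      (abs (y k) `^ p / p + (abs (f k) / C) `^ q / q))).
    apply: ler_sum => k _; apply: conjugate_powR => //.
    by rewrite divr_ge0// ltW.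
  rewrite big_split/= -!mulr_suml -pq lerD//.
    by rewrite -[leRHS]mul1r ler_wpM2r// invr_ge0 ltW.
  rewrite -[leRHS]mul1r ler_wpM2r ?invr_ge0 ?(ltW q0)//.
  under eq_bigr do rewrite powRM ?invr_ge0 ?a0 ?C0//.
  rewrite -mulr_suml -(ler_pM2r (powR_gt0 q Cgt0)) mul1r -mulrA -powRM ?invr_ge0 ?C0//.
  by rewrite mulVf ?gt_eqF// powR1 mulr1.
- have [emb [embN embA _]] := abs_embedding hK.
  set S := \sum_(0 <= k < m) abs (f k) `^ q.
  have S0 : 0 <= S by apply: sumr_ge0 => k _; exact: powR_ge0.
  have [S00|SN0] := eqVneq S 0; first by rewrite S00 powR_ge0.
  have Sgt0 : 0 < S by rewrite lt_neqAle eq_sym SN0.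
  pose ph k := if f k == 0 then 1 else emb (abs (f k)) / f k.
  pose y k := ph k * emb (abs (f k) `^ (q - 1) * S `^ (- p^-1)).
  have phA k : abs (ph k) = 1.
    rewrite /ph; case: eqVneq => [_|fk]; first exact: abs1.
    have e : emb (abs (f k)) / f k * f k = emb (abs (f k)) by rewrite divfK.
    move/(congr1 abs): e; rewrite (absM hK) embA ger0_norm// => /eqP.
    rewrite -[X in _ == X]mul1r -subr_eq0 -mulrBl mulf_eq0 (abs_eq0 hK) (negbTE fk) orbF.
    by rewrite subr_eq0 => /eqP.
  have phf k : f k * ph k = emb (abs (f k)).
    rewrite /ph; case: eqVneq => [->|fk]; first by rewrite mul0r (abs0 hK) rmorph0.
    by rewrite mulrCA divff// mulr1.
  have ay k : abs (y k) `^ p = abs (f k) `^ q / S.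
    rewrite /y (absM hK) phA mul1r embA ger0_norm ?mulr_ge0 ?powR_ge0//.
    rewrite powRM ?powR_ge0// -!powRrM; congr (_ `^ _ * _).
      have h : q + p = p * q.
        have -> : q + p = p * (p^-1 + q^-1) * q by field; rewrite pN0 qN0.
        by rewrite pq mulr1.
      by rewrite mulrBl mul1r [q * p]mulrC -h addrK.
    by rewrite mulNr mulVf// powR_inv1.
  have fy k : f k * y k = emb (abs (f k) `^ q * S `^ (- p^-1)).
    by rewrite /y mulrA phf -rmorphM mulrA mulr_powRB1.
  have := fC m y; under eq_bigr do rewrite ay.
  rewrite -mulr_suml divff// lexx => /(_ isT).
  under eq_bigr do rewrite fy.
  rewrite -rmorph_sum embA -mulr_suml ger0_norm ?mulr_ge0 ?powR_ge0// -/S.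
  have -> : S * S `^ (- p^-1) = S `^ q^-1.
    rewrite -{1}[S]powRr1// -powRD ?SN0 ?implybT//.
    by congr (_ `^ _); rewrite -pq; ring.
  move=> h; have : (S `^ q^-1) `^ q <= C `^ q.
    by apply: ge0_ler_powR => //; rewrite ?nnegrE ?powR_ge0 ?ltW.
  by rewrite -powRrM mulVf// powRr1.
Qed.

Lemma lp_dualP (p : R) f (C : R) : 1 <= p -> 0 <= C ->
  (lp_norm abs (hoelder_conjugate p%:E) f <= C%:E)%E <-> dual_le p f C.
Proof.
rewrite le_eqVlt => /predU1P[<-|p1] C0.
  by rewrite hoelder_conjugate1; exact: dual1_infty.
rewrite /hoelder_conjugate /= eqe gt_eqF ?(lt_trans ltr01)//.
rewrite -EFinB inver subr_eq0 gt_eqF// -EFinM.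
apply: dual_conjugate => //.
  by apply: divr_gt0; lra.
by field; rewrite !gt_eqF//; lra.
Qed.

End sequence_norms.

Arguments dual_le {R K} abs p f C.

(** * Functionals given by their coefficients *)

Section functionals.
Context {R : realType} {K : numFieldType} {abs : K -> R} {p : R}.
Hypothesis hK : scalar_field abs.
Hypothesis hp : 1 <= p.

Let p_gt0 : 0 < p := lt_le_trans ltr01 hp.
Let p_ge0 : 0 <= p := ltW p_gt0.
Let p_neq0 : p != 0 := lt0r_neq0 p_gt0.

Definition tail_le (y : nat -> K) (m : nat) (tau : R) : Prop := 0 <= tau /\
  forall M, \sum_(m <= k < M) abs (y k) `^ p <= tau `^ p.

Lemma powR_le_powR (a b : R) : 0 <= a -> 0 <= b -> (a `^ p <= b `^ p) = (a <= b).
Proof.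
move=> a0 b0; apply/idP/idP => h; last first.
  by apply: ge0_ler_powR; rewrite ?nnegrE.
by rewrite leNgt; apply/negP => /(gt0_ltr_powR p_gt0); rewrite !nnegrE ltNge h => /(_ b0 a0).
Qed.

Lemma tail_le_normP y tau : 0 <= tau ->
  (lp_norm abs p%:E y <= tau%:E)%E <-> tail_le y 0 tau.
Proof. by move=> t0; rewrite (lp_norm_leP hK)//; split=> [//|[]]. Qed.

Lemma lp_spaceP y : lp_space abs p%:E y <-> exists tau, tail_le y 0 tau.
Proof.
split=> [yp|[tau ytau]].
  exists (fine (lp_norm abs p%:E y)); apply/tail_le_normP.
    by rewrite fine_ge0// lp_norm_ge0.
  by rewrite fineK// ge0_fin_numE ?lp_norm_ge0.
have [t0 _] := ytau; rewrite /lp_space /=.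
by apply: le_lt_trans (ltry tau); apply/tail_le_normP.
Qed.

Lemma psum_nondecreasing y m M N : (M <= N)%N ->
  \sum_(m <= k < M) abs (y k) `^ p <= \sum_(m <= k < N) abs (y k) `^ p.
Proof.
move=> MN; have [mM|Mm] := leqP m M.
  by rewrite [leRHS](big_cat_nat (n := M))//= lerDl sumr_ge0// => *; exact: powR_ge0.
by rewrite big_geq ?(ltnW Mm)// sumr_ge0// => *; exact: powR_ge0.
Qed.

Lemma tail_leS y m m' tau : (m <= m')%N -> tail_le y m tau -> tail_le y m' tau.
Proof.
move=> mm' [t0 h]; split=> // M; apply: le_trans (h M).
have [m'M|Mm'] := leqP m' M.
  by rewrite [leRHS](big_cat_nat (n := m'))//= lerDr sumr_ge0// => *; exact: powR_ge0.
by rewrite big_geq ?(ltnW Mm')// sumr_ge0// => *; exact: powR_ge0.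
Qed.

Lemma tail_le_coef y m tau k : tail_le y m tau -> (m <= k)%N -> abs (y k) <= tau.
Proof.
move=> [t0 h] mk; rewrite -powR_le_powR ?(abs_ge0 hK)//; apply: le_trans (h k.+1).
by rewrite big_nat_recr//= lerDr sumr_ge0// => *; exact: powR_ge0.
Qed.

Lemma tail_small y e : lp_space abs p%:E y -> 0 < e ->
  \forall m \near \oo, tail_le y m e.
Proof.
move=> /lp_spaceP[tau [t0 ytau]] e0.
pose s m := \sum_(0 <= k < m) abs (y k) `^ p.
have hs : has_sup (range s).
  split; first by exists (s 0%N); exists 0%N.
  by exists (tau `^ p) => _ [m _ <-]; exact: ytau.
have [_ [m0 _ <-] hm0] := sup_adherent (powR_gt0 p e0) hs.
suff h : tail_le y m0 e by exists m0 => // m /= mm; exact: tail_leS h.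
split=> [|M]; first exact: ltW.
have [mM|Mm] := leqP m0 M; last by rewrite big_geq ?powR_ge0// ltnW.
have : s M <= sup (range s) by apply: ub_le_sup; [case: hs|exists M].
by rewrite {1}/s (big_cat_nat (n := m0))//= -/(s m0); lra.
Qed.

Lemma tail_le_lp y m tau : tail_le y m tau -> lp_space abs p%:E y.
Proof.
move=> [t0 hy]; apply/lp_spaceP.
exists ((\sum_(0 <= k < m) abs (y k) `^ p + tau `^ p) `^ p^-1).
split=> [|M]; first exact: powR_ge0.
rewrite -powRrM mulVf// powRr1; last first.
  by rewrite addr_ge0 ?powR_ge0// sumr_ge0// => *; exact: powR_ge0.
apply: le_trans (psum_nondecreasing _ _ (leq_addr m M)) _.
by rewrite (big_cat_nat (n := m)) ?leq_addl//= lerD2l.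
Qed.

Lemma dual_le_ge0 f C : dual_le abs p f C -> 0 <= C.
Proof.
by move=> /(_ 0%N (fun=> 0)); rewrite !big_geq// (abs0 hK); apply; rewrite ler01.
Qed.

(** Rescaling extends the bound from the unit ball, and from initial segments
    to arbitrary segments. *)
Lemma dual_le_segment f C y m M tau : dual_le abs p f C -> tail_le y m tau ->
  abs (\sum_(m <= k < M) f k * y k) <= C * tau.
Proof.
move=> fC ytau; have [t0 h] := ytau.
have [mM|Mm] := leqP m M; last first.
  by rewrite big_geq ?(ltnW Mm)// (abs0 hK) mulr_ge0// (dual_le_ge0 fC).
have [emb [_ embA _]] := abs_embedding hK.
have [t00|tN0] := eqVneq tau 0.
  rewrite t00 mulr0 big_nat big1 ?(abs0 hK)// => k /andP[mk _].
  have /eqP : abs (y k) = 0.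
    by apply/eqP; rewrite eq_le (abs_ge0 hK) -t00 (tail_le_coef ytau mk).
  by rewrite (abs_eq0 hK) => /eqP ->; rewrite mulr0.
have tgt0 : 0 < tau by rewrite lt_neqAle eq_sym tN0.
pose z k := if (m <= k)%N then y k * emb tau^-1 else 0.
have eN0 : emb tau != 0 by rewrite fmorph_eq0.
have zE (V : nmodType) (F : nat -> K -> V) : (forall k, F k 0 = 0) ->
    \sum_(0 <= k < M) F k (z k) = \sum_(m <= k < M) F k (y k * emb tau^-1).
  move=> F0; rewrite (big_cat_nat (n := m))//= big_nat big1 ?add0r; last first.
    by move=> k /andP[_ km]; rewrite /z leqNgt km F0.
  by apply: eq_big_nat => k /andP[mk _]; rewrite /z mk.
have /fC : \sum_(0 <= k < M) abs (z k) `^ p <= 1.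
  rewrite (zE _ (fun _ x => abs x `^ p)); last by rewrite (abs0 hK) powR0.
  under eq_bigr do rewrite (absM hK) embA gtr0_norm ?invr_gt0//
    powRM ?invr_ge0 ?(abs_ge0 hK)//.
  rewrite -mulr_suml -(ler_pM2r (powR_gt0 p tgt0)) mul1r -mulrA -powRM ?invr_ge0//.
  by rewrite mulVf// powR1 mulr1.
rewrite (zE _ (fun k x => f k * x)); last by move=> k; rewrite mulr0.
under eq_bigr do rewrite mulrA.
rewrite -mulr_suml (absM hK) embA gtr0_norm ?invr_gt0//.
by rewrite ler_pdivrMr.
Qed.

(** [G] is the functional with coefficients [f] and norm at most [C]: the error
    of each partial sum is controlled by the corresponding tail of the argument.
    Unlike a series, this form survives pointwise limits. *)
Definition represents (G : (nat -> K) -> K) (f : nat -> K) (C : R) : Prop :=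
  forall y m tau, tail_le y m tau ->
    abs (G y - \sum_(0 <= k < m) f k * y k) <= C * tau.

Lemma represents_finite f N : (forall k, (N <= k)%N -> f k = 0) ->
  represents (fun y => \sum_(0 <= k < N) f k * y k) f (\sum_(0 <= k < N) abs (f k)).
Proof.
move=> f0 y m tau ytau; have [t0 _] := ytau.
have S0 M : 0 <= \sum_(M <= k < N) abs (f k) by apply: sumr_ge0 => *; exact: abs_ge0.
have [mN|Nm] := leqP m N; last first.
  rewrite [X in _ - X](big_cat_nat (n := N)) ?(ltnW Nm)//= [X in _ - (_ + X)]big_nat.
  rewrite [X in _ - (_ + X)]big1 => [|k /andP[Nk _]]; last by rewrite f0// mul0r.
  by rewrite addr0 subrr (abs0 hK) mulr_ge0.
rewrite (big_cat_nat (n := m))//= [in leRHS](big_cat_nat (n := m))//=.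
rewrite addrAC subrr add0r (le_trans (abs_sum hK _ _ _))// mulrDl ler_wpDl ?mulr_ge0//.
  by apply: sumr_ge0 => *; exact: abs_ge0.
rewrite mulr_suml ler_sum_nat// => k /andP[mk _].
by rewrite (absM hK) ler_wpM2l ?(abs_ge0 hK)// (tail_le_coef ytau).
Qed.

Lemma represents_truncated G f C y m : represents G f C ->
  (forall k, (m <= k)%N -> y k = 0) -> G y = \sum_(0 <= k < m) f k * y k.
Proof.
move=> Gf y0; have /Gf : tail_le y m 0.
  split=> // M; rewrite big_nat big1 ?powR_ge0// => k /andP[mk _].
  by rewrite y0// (abs0 hK) powR0.
rewrite mulr0 => h; apply/eqP; rewrite -subr_eq0 -(abs_eq0 hK) eq_le h.
exact: abs_ge0.
Qed.

Lemma truncate_sum (V : nmodType) (F : nat -> K -> V) (y : nat -> K) m :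
  \sum_(0 <= k < m) F k (if (k < m)%N then y k else 0) = \sum_(0 <= k < m) F k (y k).
Proof. by apply: eq_big_nat => k /andP[_ ->]. Qed.

Lemma truncate_tail y m : \sum_(0 <= k < m) abs (y k) `^ p <= 1 ->
  tail_le (fun k => if (k < m)%N then y k else 0) 0 1.
Proof.
move=> y1; split=> // M; rewrite powR1.
pose y' k := if (k < m)%N then y k else 0; rewrite -/y'.
apply: le_trans (psum_nondecreasing _ _ (leq_addr m M)) _.
rewrite (big_cat_nat (n := m)) ?leq_addl//= (truncate_sum (fun _ x => abs x `^ p)).
rewrite [X in _ + X]big_nat [X in _ + X]big1 ?addr0// => k /andP[mk _].
by rewrite /y' ltnNge mk (abs0 hK) powR0.
Qed.

Lemma represents_dual_le G f C : represents G f C -> dual_le abs p f C.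
Proof.
move=> Gf m y /truncate_tail /Gf; rewrite mulr1 big_geq// subr0.
rewrite (@represents_truncated _ _ _ _ m Gf); last by move=> k; rewrite leqNgt => /negbTE ->.
by rewrite (truncate_sum (fun k x => f k * x)).
Qed.

(** The norm of a functional is the least dual bound: tails of a fixed
    argument vanish, so the constant of a crude representation is immaterial. *)
Lemma represents_sharpen G f C C' :
  represents G f C' -> dual_le abs p f C -> represents G f C.
Proof.
move=> Gf fC y m tau ytau; have [t0 hy] := ytau.
have C'0 := dual_le_ge0 (represents_dual_le Gf).
have C'1 : 0 < C' + 1 by lra.
apply/ler_addgt0Pr => e e0.
have ylp := tail_le_lp ytau.
have e0' : 0 < e / (C' + 1) by rewrite divr_gt0.
have [M [Me mM]] := filter_ex (filterI (tail_small ylp e0') (nbhs_infty_ge m)).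
rewrite -(subrKA (\sum_(0 <= k < M) f k * y k)) addrC.
rewrite (le_trans (abs_triangle hK _ _))// lerD//.
  rewrite (big_cat_nat (n := m))//= [X in abs (X - _)]addrC addrK.
  exact: dual_le_segment ytau.
rewrite (le_trans (Gf _ _ _ Me))// mulrA ler_pdivrMr//.
by rewrite mulrC ler_pM2l//; lra.
Qed.

(** The estimate for a fixed partial sum involves finitely many coefficients. *)
Lemma represents_lim (G : nat -> (nat -> K) -> K) (f : nat -> nat -> K) C G' f' :
  (forall n, represents (G n) (f n) C) ->
  (forall y, lp_space abs p%:E y -> G ^~ y @ \oo --> G' y) ->
  (forall k, f ^~ k @ \oo --> f' k) -> 
  represents G' f' C.
Proof.
move=> Gf GG' ff' y m tau ytau.
have h : (fun n => G n y - \sum_(0 <= k < m) f n k * y k) @ \oo -->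
    G' y - \sum_(0 <= k < m) f' k * y k.
  apply: cvgB; first exact/GG'/(tail_le_lp ytau).
  apply: cvg_big => // [|k _]; first exact: add_continuous.
  by apply: cvgM; [exact: ff'|exact: cvg_cst].
rewrite -[X in abs X]subr0; apply: (abs_cvg_le hK h).
by apply: nearW => n; rewrite subr0; exact: Gf.
Qed.

Lemma representsB G G' f f' C C' : represents G f C -> represents G' f' C' ->
  represents (fun y => G y - G' y) (fun k => f k - f' k) (C + C').
Proof.
move=> Gf Gf' y m tau ytau.
under eq_bigr do rewrite mulrBl.
rewrite sumrB mulrDl.
set a := \sum_(_ <= _ < _) _; set b := \sum_(_ <= _ < _) _.
have -> : G y - G' y - (a - b) = (G y - a) - (G' y - b) by ring.
by rewrite (le_trans (abs_triangle hK _ _))// (absN hK) lerD ?Gf ?Gf'.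
Qed.

End functionals.

Arguments tail_le {R K} abs p y m tau.
Arguments represents {R K} abs p G f C.

(** * Uniform boundedness *)

Section uniform_boundedness.
Context {R : realType} {K : numFieldType} {abs : K -> R} {p : R}.
Hypothesis hK : scalar_field abs.
Hypothesis hp : 1 <= p.

Let p_gt0 : 0 < p := lt_le_trans ltr01 hp.
Let p_neq0 : p != 0 := lt0r_neq0 p_gt0.

(** Halving the weights at each block keeps the whole sequence in [l_p]: the
    bound telescopes, since [w^p <= 2 (w^p - (w/2)^p)] when [p >= 1]. *)
Lemma blocks_tail_le (y : nat -> K) (m : nat -> nat) (w : nat -> R) :
  (forall i, (m i < m i.+1)%N) -> (forall i, 0 <= w i) ->
  (forall i, w i.+1 <= w i / 2) ->
  (forall i, \sum_(m i <= k < m i.+1) abs (y k) `^ p <= w i `^ p) ->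
  forall i, tail_le abs p y (m i) (2 * w i).
Proof.
move=> mS w0 wS hy i; split=> [|M]; first by rewrite mulr_ge0.
have wp0 j : 0 <= w j `^ p by exact: powR_ge0.
have two_p : 2 <= 2 `^ p :> R by apply: le1r_powR => //; lra.
have mono j : (m i <= m (i + j))%N.
  by elim: j => [|j IH]; [rewrite addn0|rewrite addnS (leq_trans IH)// ltnW].
have partial j : \sum_(m i <= k < m (i + j)%N) abs (y k) `^ p <=
    2 * w i `^ p - 2 * w (i + j)%N `^ p.
  elim: j => [|j IH]; first by rewrite addn0 big_geq// subrr.
  rewrite addnS (big_cat_nat (n := m (i + j)%N))//=; last exact: ltnW.
  have : w (i + j).+1 `^ p <= w (i + j)%N `^ p / 2.
    apply: (@le_trans _ _ ((w (i + j)%N / 2) `^ p)).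
      by rewrite (powR_le_powR hp)// divr_ge0.
    rewrite powRM ?invr_ge0// ler_wpM2l// -powR_inv1// -powRrM mulN1r powRN.
    by rewrite powR_inv1// lef_pV2// posrE ?powR_gt0.
  by have := hy (i + j)%N; lra.
have [j Mj] : exists j, (M <= m (i + j))%N.
  exists M; elim: M => // j IH; by rewrite addnS (leq_ltn_trans IH).
rewrite (le_trans (psum_nondecreasing y _ Mj))// (le_trans (partial j))//.
rewrite powRM//; apply: (@le_trans _ _ (2 * w i `^ p)).
  by rewrite gerBl mulr_ge0.
by rewrite ler_wpM2r.
Qed.

(** The first [m] coordinates contribute a bounded amount to all the functionals,
    so a large value has to come from the coordinates beyond them. *)
Lemma hump (f : nat -> nat -> K) (Bd : nat -> R) :
  (forall k n, abs (f n k) <= Bd k) ->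
  (forall C : R, 0 <= C -> exists n, ~ dual_le abs p (f n) C) ->
  forall m B, exists n M z, [/\ (m < M)%N,
    \sum_(m <= k < M) abs (z k) `^ p <= 1 &
    B <= abs (\sum_(m <= k < M) f n k * z k)].
Proof.
move=> fB unbounded m B.
have Bd0 k : 0 <= Bd k by apply: le_trans (fB k 0%N); exact: abs_ge0.
have [n] := unbounded (`|B| + \sum_(0 <= k < m) Bd k)
  (addr_ge0 (normr_ge0 _) (sumr_ge0 _ (fun k _ => Bd0 k))).
move=> /existsNP[M /existsNP[z0 /not_implyP[z1 /negP]]]; rewrite -ltNge => hB.
(* Padding by zeros makes the block that starts at [m] nonempty. *)
pose z k := if (k < M)%N then z0 k else 0.
have zM (V : nmodType) (F : nat -> K -> V) : (forall k, F k 0 = 0) ->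
    \sum_(0 <= k < M + m.+1) F k (z k) = \sum_(0 <= k < M) F k (z0 k).
  move=> F0; rewrite (big_cat_nat (n := M)) ?leq_addr//= (truncate_sum F).
  rewrite [X in _ + X]big_nat [X in _ + X]big1 ?addr0// => k /andP[Mk _].
  by rewrite /z ltnNge Mk.
have mM : (m < M + m.+1)%N by rewrite leq_addl.
have z1' : \sum_(0 <= k < M + m.+1) abs (z k) `^ p <= 1.
  by rewrite (zM _ (fun _ x => abs x `^ p))// (abs0 hK) powR0.
exists n, (M + m.+1)%N, z; split=> //.
  apply: le_trans z1'; rewrite [leRHS](big_cat_nat (n := m)) ?(ltnW mM)//=.
  by rewrite lerDr sumr_ge0// => *; exact: powR_ge0.
move: hB; rewrite -(zM _ (fun k x => f n k * x)); last by move=> k; rewrite mulr0.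
rewrite [X in abs X](big_cat_nat (n := m)) ?(ltnW mM)//= => hB.
have := lt_le_trans hB (abs_triangle hK _ _).
have : abs (\sum_(0 <= k < m) f n k * z k) <= \sum_(0 <= k < m) Bd k.
  apply: le_trans (abs_sum hK _ _ _) _; apply: ler_sum_nat => k /andP[_ km].
  rewrite (absM hK) -[leRHS]mulr1 ler_pM ?(abs_ge0 hK)//.
  have zt : tail_le abs p (fun k => if (k < M + m.+1)%N then z k else 0) 0 1.
    exact: (truncate_tail hK hp z1').
  by have := tail_le_coef hK hp zt (leq0n k); rewrite ltn_addl// ltnS ltnW.
have := ler_norm B; lra.
Qed.

(** The gliding hump. The weight of each block is chosen after the norms of the
    functionals used so far, so that at the argument assembled from the blocks
    the [i]-th functional sees the later blocks with total weight at most [1]. *)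
Lemma uniform_boundedness (G : nat -> (nat -> K) -> K) (f : nat -> nat -> K)
    (C : nat -> R) :
  (forall n, represents abs p (G n) (f n) (C n)) ->
  (forall y, lp_space abs p%:E y -> exists B, forall n, abs (G n y) <= B) ->
  exists2 B, 0 <= B & forall n, dual_le abs p (f n) B.
Proof.
move=> Gf Gy; apply: contrapT => unbounded'.
have unbounded B : 0 <= B -> exists n, ~ dual_le abs p (f n) B.
  by move=> B0; apply/existsNP => fB; apply: unbounded'; exists B.
have C0 n : 0 <= C n := dual_le_ge0 hK (represents_dual_le hK hp (Gf n)).
have /choice[Bd fBd] : forall k, exists B, forall n, abs (f n k) <= B.
  move=> k; pose d j : K := (j == k)%:R.
  have dk j : (k < j)%N -> d j = 0 by move=> kj; rewrite /d gtn_eqF.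
  have dlp : lp_space abs p%:E d.
    apply: (@tail_le_lp _ _ _ _ hK hp _ k.+1 0); split=> // M.
    rewrite big_nat big1 ?powR_ge0// => j /andP[kj _].
    by rewrite dk// (abs0 hK) powR0.
  have [B GB] := Gy d dlp; exists B => n.
  have := GB n; rewrite (represents_truncated hK hp (Gf n) dk).
  rewrite (@single_sum _ _ k)// /d ?eqxx ?mulr1//.
  by move=> j /negbTE ->; rewrite mulr0.
have Bd0 k : 0 <= Bd k by apply: le_trans (fBd k 0%N); exact: abs_ge0.
have /choice[F hF] : forall x : nat * R, exists q : nat * nat * (nat -> K),
    [/\ (x.1 < q.1.2)%N, \sum_(x.1 <= k < q.1.2) abs (q.2 k) `^ p <= 1 &
        x.2 <= abs (\sum_(x.1 <= k < q.1.2) f q.1.1 k * q.2 k)].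
  move=> [m B]; have [n [M [z h]]] := hump fBd unbounded m B.
  by exists (n, M, z).
(* The contribution of the [i]-th block is to exceed by [i] those of the later
   blocks, at most [1], and of the earlier coordinates, at most [2] in modulus. *)
pose need (i m : nat) (w : R) := (i%:R + 1 + 2 * \sum_(0 <= k < m) Bd k) / w.
pose fix st i : nat * R := if i is j.+1 then
    let q := F ((st j).1, need j (st j).1 (st j).2) in
    (q.1.2, (st j).2 / (2 * (1 + C q.1.1)))
  else (0%N, 1).
pose m i := (st i).1; pose w i := (st i).2.
pose q i := F (m i, need i (m i) (w i)).
pose n i := (q i).1.1; pose z i := (q i).2.
have mE i : m i.+1 = (q i).1.2 by [].
have wE i : w i.+1 = w i / (2 * (1 + C (n i))) by [].
have mS i : (m i < m i.+1)%N by have [] := hF (m i, need i (m i) (w i)).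
have zS i : \sum_(m i <= k < m i.+1) abs (z i k) `^ p <= 1.
  by have [] := hF (m i, need i (m i) (w i)).
have fz i : need i (m i) (w i) <= abs (\sum_(m i <= k < m i.+1) f (n i) k * z i k).
  by have [] := hF (m i, need i (m i) (w i)).
have w0 i : 0 < w i.
  elim: i => [|i IH]; first exact: ltr01.
  by rewrite wE divr_gt0// mulr_gt0// ltr_wpDr.
have wS i : w i.+1 <= w i / 2.
  rewrite wE ler_pM2l// lef_pV2 ?posrE ?mulr_gt0 ?ltr_wpDr// ler_peMr//.
  by rewrite lerDl.
have w1 i : w i <= 1.
  by elim: i => [|i IH]; [exact: lexx|have := wS i; have := w0 i; lra].
have mi i : (i <= m i)%N by elim: i => // i IH; exact: leq_ltn_trans (mS i).
have mono i j : (i <= j)%N -> (m i <= m j)%N.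
  move=> /subnKC <-; elim: (j - i)%N => [|d IH]; first by rewrite addn0.
  by rewrite addnS (leq_trans IH)// ltnW.
have [emb [_ embA _]] := abs_embedding hK.
pose y k := \sum_(0 <= i < k.+1)
  (if (m i <= k < m i.+1)%N then emb (w i) * z i k else 0).
have yE i k : (m i <= k < m i.+1)%N -> y k = emb (w i) * z i k.
  move=> /andP[ik ki]; rewrite /y (@single_sum _ _ i) ?ik ?ki//.
    by rewrite ltnS (leq_trans (mi i)).
  move=> j; rewrite neq_ltn => /orP[ji|ij]; case: ifP => // /andP[jk kj].
    by have := leq_trans kj (leq_trans (mono _ _ ji) ik); rewrite ltnn.
  by have := leq_trans ki (leq_trans (mono _ _ ij) jk); rewrite ltnn.
have ytail : forall i, tail_le abs p y (m i) (2 * w i).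
  apply: blocks_tail_le => // i; first exact: ltW.
  rewrite (eq_big_nat _ _ (F2 := fun k => w i `^ p * abs (z i k) `^ p)).
    by rewrite -mulr_sumr ler_piMr ?powR_ge0.
  move=> k hk; rewrite (yE i)// (absM hK) embA gtr0_norm// powRM ?(abs_ge0 hK)//.
  exact: ltW.
have [B GB] := Gy y (tail_le_lp hK hp (ytail 0%N)).
pose i := (Num.truncn `|B|).+1.
have Bi : B < i%:R.
  by rewrite (le_lt_trans (ler_norm B))//; have /andP[] := truncn_itv (normr_ge0 B).
have := GB (n i); apply/negP; rewrite -ltNge; apply: (lt_le_trans Bi).
have later : abs (G (n i) y - \sum_(0 <= k < m i.+1) f (n i) k * y k) <= 1.
  apply: le_trans (Gf (n i) _ _ _ (ytail i.+1)) _.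
  rewrite wE; have := w1 i; have := C0 (n i) => Cn0 wi1.
  have -> : C (n i) * (2 * (w i / (2 * (1 + C (n i))))) = w i * (C (n i) / (1 + C (n i))).
    by field; rewrite gt_eqF// ltr_wpDr.
  rewrite mulr_ile1 ?(ltW (w0 i))//; first by rewrite divr_ge0// addr_ge0.
  by rewrite ler_pdivrMr ?ltr_wpDr// mul1r lerDr.
have earlier : abs (\sum_(0 <= k < m i) f (n i) k * y k) <=
    2 * \sum_(0 <= k < m i) Bd k.
  apply: le_trans (abs_sum hK _ _ _) _; rewrite mulr_sumr.
  apply: ler_sum_nat => k _; rewrite (absM hK) mulrC ler_pM ?(abs_ge0 hK)//.
  by have := tail_le_coef hK hp (ytail 0%N) (leq0n k); rewrite /w /= mulr1.
have block : i%:R + 1 + 2 * \sum_(0 <= k < m i) Bd k <=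
    abs (\sum_(m i <= k < m i.+1) f (n i) k * y k).
  rewrite (eq_big_nat _ _ (F2 := fun k => emb (w i) * (f (n i) k * z i k))).
    rewrite -mulr_sumr (absM hK) embA gtr0_norm//.
    by have := fz i; rewrite /need ler_pdivrMr// [w i * _]mulrC.
  by move=> k hk; rewrite (yE i)// mulrCA.
move: later; rewrite [X in _ - X](big_cat_nat (n := m i)) ?(ltnW (mS i))//= => later.
set a := \sum_(_ <= _ < _) _ in later earlier.
set b := \sum_(_ <= _ < _) _ in later block.
have h1 := abs_le_sub hK b (- (G (n i) y - (a + b))).
have h2 := abs_triangle hK (G (n i) y) (- a).
have e : b - - (G (n i) y - (a + b)) = G (n i) y - a by ring.
rewrite e (absN hK) in h1; rewrite (absN hK) in h2.
lra.
Qed.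

End uniform_boundedness.

(** * The inverse of the triangle *)

Lemma triangle_exchange (V : nmodType) (F : nat -> nat -> V) m N :
  \sum_(m <= j < N) \sum_(m <= i < j.+1) F j i =
  \sum_(m <= i < N) \sum_(i <= j < N) F j i.
Proof.
elim: N => [|N IH]; first by rewrite !big_geq.
have [mN|Nm] := leqP m N; last by rewrite !big_geq.
rewrite big_nat_recr//= IH [RHS]big_nat_recr//= big_nat1.
rewrite [X in _ + X]big_nat_recr//= addrA; congr (_ + _).
rewrite -big_split/=; apply: eq_big_nat => i /andP[_ iN].
by rewrite big_nat_recr// ltnW.
Qed.

Definition convolution (K : nzRingType) (a b : nat -> K) (n : nat) : K :=
  \sum_(0 <= k < n.+1) a (n - k)%N * b k.

Section convolution.
Context {K : comNzRingType}.
Implicit Types a b c : nat -> K.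

(** Convolution is multiplication of power series; truncating at [n] turns it
    into multiplication of polynomials. *)
Lemma coef_convolution a b n k : (k <= n)%N ->
  ((\poly_(i < n.+1) a i) * (\poly_(i < n.+1) b i))`_k = convolution a b k.
Proof.
move=> kn; rewrite coefMr /convolution big_mkord; apply: eq_bigr => i _.
by rewrite !coef_poly !ltnS (leq_trans _ kn) ?leq_subr// (leq_trans (leq_ord i) kn).
Qed.

Lemma convolutionC a b : convolution a b =1 convolution b a.
Proof. by move=> n; rewrite -!(coef_convolution _ _ (leqnn n)) mulrC. Qed.

Lemma eq_convolution a a' b b' : a =1 a' -> b =1 b' ->
  convolution a b =1 convolution a' b'.
Proof. by move=> aa' bb' n; apply: eq_bigr => k _; rewrite aa' bb'. Qed.

Lemma convolutionA a b c :
  convolution a (convolution b c) =1 convolution (convolution a b) c.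
Proof.
move=> n; pose P (f : nat -> K) := \poly_(i < n.+1) f i.
have : (P a * (P b * P c))`_n = (P a * P b * P c)`_n by rewrite mulrA.
rewrite coefMr [RHS]coefMr => e.
rewrite /convolution !big_mkord.
transitivity (\sum_(j < n.+1) (P a)`_(n - j) * (P b * P c)`_j).
  apply: eq_bigr => j _; rewrite coef_convolution ?leq_ord//.
  by rewrite coef_poly ltnS leq_subr.
rewrite e; apply: eq_bigr => j _; rewrite coef_convolution ?leq_subr//.
by rewrite coef_poly ltnS leq_ord.
Qed.

Lemma convolution_unitl c : convolution (fun k => (k == 0)%:R) c =1 c.
Proof.
move=> n; rewrite /convolution big_nat_recr//= subnn mul1r big_nat big1 ?add0r//.
by move=> k /andP[_ kn]; rewrite subn_eq0 leqNgt kn mul0r.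
Qed.

End convolution.

Lemma convolution_inverse (K : fieldType) (s : nat -> K) : s 0%N != 0 ->
  exists x, convolution s x =1 fun n => (n == 0)%:R.
Proof.
move=> s0.
pose next (X : nat -> K) n := - (\sum_(0 <= i < n) s (n - i)%N * X i) / s 0%N.
pose fix X (n : nat) : nat -> K := if n is m.+1 then
  fun k => if k == m.+1 then next (X m) m.+1 else X m k else fun=> (s 0%N)^-1.
have XS n k : (k <= n)%N -> X n.+1 k = X n k by move=> kn /=; rewrite ltn_eqF.
have Xk n k : (k <= n)%N -> X n k = X k k.
  move=> /subnKC <-; elim: (n - k)%N => [|d IH]; first by rewrite addn0.
  by rewrite addnS XS ?leq_addr.
exists (fun n => X n n) => -[|n] /=.
  by rewrite /convolution big_nat1 /= divff.
rewrite /convolution big_nat_recr//= eqxx subnn /next mulrC divfK//.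
apply/eqP; rewrite subr_eq0; apply/eqP; apply: eq_big_nat => i /andP[_ iN].
by rewrite (Xk n i).
Qed.

(** The coefficients of [1/s] by Cramer's rule: truncating at [n], the inverse
    sequence solves the system of a lower triangular Toeplitz matrix whose
    right-hand side is the first unit vector, and the relevant cofactor is the
    Hessenberg determinant in the definition of [D_s]. *)
Lemma D_s_convolution (K : numFieldType) (s : nat -> K) : s 0%N != 0 ->
  convolution s (fun n => (-1) ^+ n * D_s s n) =1 fun n => (n == 0)%:R.
Proof.
move=> s0; have [x sx] := convolution_inverse s0.
suff Dx n : (-1) ^+ n * D_s s n = x n.
  by move=> n; rewrite -sx; apply: eq_convolution.
case: n => [|n].
  have := sx 0%N; rewrite /convolution big_nat1 /= => h.
  by apply: (mulfI s0); rewrite h expr0 mul1r divff.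
pose M : 'M[K]_n.+2 := \matrix_(i, j) (if (j <= i)%N then s (i - j)%N else 0).
have detM : \det M = s 0%N ^+ n.+2.
  rewrite det_trig; last first.
    by apply/is_trig_mxP => i j ij; rewrite mxE leqNgt ij.
  under eq_bigr do rewrite mxE leqnn subnn.
  by rewrite prodr_const card_ord.
have Mx : M *m (\col_i x i) = \col_i (i == 0 :> nat)%:R.
  apply/colP => i; rewrite !mxE -sx /convolution big_mkord.
  rewrite (big_ord_widen n.+2 (fun k => s (i - k)%N * x k) (ltn_ord i)).
  rewrite [RHS]big_mkcond; apply: eq_bigr => j _; rewrite !mxE ltnS.
  by case: ifP => //; rewrite mul0r.
have := congr1 (fun B : 'cV_n.+2 => B ord_max 0) (congr1 (mulmx (\adj M)) Mx).
rewrite /= mulmxA mul_adj_mx mul_scalar_mx detM !mxE big_ord_recl !mxE eqxx mulr1.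
rewrite big1 ?addr0 => [|i _]; last by rewrite !mxE mulr0.
rewrite /cofactor add0n => h.
have sN0 : s 0%N ^+ n.+2 != 0 by rewrite expf_neq0.
apply: (mulfI sN0); rewrite h mulrCA /D_s mulVKf//.
congr (_ * \det _); apply/matrixP => i j; rewrite !mxE.
by rewrite lift_max lift0.
Qed.

Section finite_series.
Context {K : numFieldType}.
Implicit Types F G : nat -> K.

Lemma tsum_eq (m : nat) F l : psum_from m F @ \oo --> l -> tsum m F = l.
Proof. exact: norm_cvg_lim. Qed.

Lemma tsum_finite F N : (forall j, (N <= j)%N -> F j = 0) ->
  tsum 0 F = \sum_(0 <= j < N) F j.
Proof.
move=> F0; apply: tsum_eq; apply: cvg_near_cst.
near=> M; rewrite /psum_from (big_cat_nat (n := N))//=; last first.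
  by near: M; exact: nbhs_infty_ge.
rewrite [X in _ + X]big_nat [X in _ + X]big1 ?addr0// => j /andP[Nj _].
exact: F0.
Unshelve. all: by end_near. Qed.

Lemma summable_cvg m F : summable_from m F -> psum_from m F @ \oo --> tsum m F.
Proof. by []. Qed.

Lemma summable_tail m N F : (m <= N)%N -> summable_from m F ->
  psum_from N F @ \oo --> tsum m F - \sum_(m <= j < N) F j.
Proof.
move=> mN mF.
have h : (fun M => psum_from m F M - \sum_(m <= j < N) F j) @ \oo -->
    tsum m F - \sum_(m <= j < N) F j.
  by apply: cvgB; [exact: summable_cvg|exact: cvg_cst].
apply: cvg_trans h; apply: near_eq_cvg; near=> M.
have NM : (N <= M)%N by near: M; exact: nbhs_infty_ge.
by rewrite /psum_from (big_cat_nat mN NM)/= addrAC subrr add0r.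
Unshelve. all: by end_near. Qed.

Lemma tsum_tail m N F : (m <= N)%N -> summable_from m F ->
  tsum m F = \sum_(m <= j < N) F j + tsum N F.
Proof. by move=> mN mF; rewrite (tsum_eq (summable_tail mN mF)) addrC subrK. Qed.

Lemma psum_scale m (c : K) F G : (forall j, (m <= j)%N -> G j = c * F j) ->
  psum_from m G = (fun N => c * psum_from m F N).
Proof.
move=> GF; apply/funext => N; rewrite /psum_from mulr_sumr.
by apply: eq_big_nat => j /andP[mj _]; exact: GF.
Qed.

Lemma tsum_scale m (c : K) F G : summable_from m F ->
  (forall j, (m <= j)%N -> G j = c * F j) -> tsum m G = c * tsum m F.
Proof.
move=> mF GF; apply: tsum_eq; rewrite (psum_scale GF).
by apply: cvgMl_tmp; exact: summable_cvg.
Qed.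

End finite_series.

Section triangle.
Context {K : numFieldType} (r s t : nat -> K) (u v : K).
Hypotheses (hr : forall n, r n != 0) (ht : forall n, t n != 0).
Hypotheses (hs : s 0%N != 0) (hu : u != 0).
Implicit Types x y w : nat -> K.

Let T x := mx_apply (mx_mul (A_rst r s t) (B_uv u v)) x.
Let C n : K := (-1) ^+ n * D_s s n.

Definition two_term (x : nat -> K) (n : nat) : K :=
  u * x n + (if n is m.+1 then v * x m else 0).

Lemma triangleE x : T x =1
  fun n => convolution s (fun k => t k * two_term x k) n / r n.
Proof.
move=> n.
have E k : mx_mul (A_rst r s t) (B_uv u v) n k =
    A_rst r s t n k * u + A_rst r s t n k.+1 * v.
  rewrite /mx_mul (@tsum_finite _ _ k.+2) => [|j kj].
    rewrite !big_nat_recr//= big_nat big1 ?add0r => [|j /andP[_ jk]].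
      by rewrite /B_uv eqxx ltn_eqF// eqxx.
    by rewrite /B_uv !gtn_eqF ?mulr0// ltnW.
  by rewrite /B_uv !ltn_eqF ?mulr0// ltnW.
rewrite /T /mx_apply (@tsum_finite _ _ n.+1) => [|k nk]; last first.
  by rewrite E /A_rst leqNgt nk leqNgt ltnW// !mul0r addr0 mul0r.
under eq_bigr do rewrite E mulrDl.
rewrite big_split/= [X in _ + X]big_nat_recr//= [X in _ + (_ + X)](_ : _ = 0).
  rewrite addr0 /convolution mulr_suml.
  under [RHS]eq_bigr do rewrite mulrDr mulrDr mulrDl.
  rewrite big_split/= [X in _ = _ + X]big_nat_recl//= !mulr0 mul0r add0r; congr (_ + _).
    by apply: eq_big_nat => k /andP[_ kn]; rewrite /A_rst -ltnS kn; ring.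
  by apply: eq_big_nat => k /andP[_ kn]; rewrite /A_rst kn; ring.
by rewrite /A_rst ltnn !mul0r.
Qed.

Definition deconvolved (y : nat -> K) (i : nat) : K :=
  convolution C (fun k => r k * y k) i / t i.

Definition triangle_inv (y : nat -> K) (j : nat) : K :=
  \sum_(0 <= i < j.+1) (- v) ^+ (j - i) / u ^+ (j - i).+1 * deconvolved y i.

Lemma triangle_inv0 y : triangle_inv y 0 = deconvolved y 0 / u.
Proof. by rewrite /triangle_inv big_nat1 /= expr0 expr1 mul1r mulrC. Qed.

Lemma triangle_invS y j : triangle_inv y j.+1 =
  deconvolved y j.+1 / u - v / u * triangle_inv y j.
Proof.
rewrite /triangle_inv big_nat_recr//= subnn expr0 expr1 mul1r [RHS]addrC.
rewrite [u^-1 * _]mulrC; congr (_ + _).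
rewrite -mulNr mulr_sumr; apply: eq_big_nat => i /andP[_]; rewrite ltnS => ij.
rewrite subSn// exprS [u ^+ (_ - _).+2]exprS; field.
by rewrite expf_neq0.
Qed.

Lemma two_term_inv y : two_term (triangle_inv y) =1 deconvolved y.
Proof.
case=> [|j]; rewrite /two_term; first by rewrite triangle_inv0 addr0 mulrC divfK.
by rewrite triangle_invS; field.
Qed.

Lemma convolution_DK a : convolution s (convolution C a) =1 a.
Proof.
move=> n; rewrite convolutionA.
rewrite (eq_convolution (D_s_convolution hs) (fun=> erefl)).
exact: convolution_unitl.
Qed.

Lemma convolution_KD a : convolution C (convolution s a) =1 a.
Proof.
move=> n; rewrite convolutionA.
rewrite (eq_convolution (convolutionC C s) (fun=> erefl)).
rewrite -convolutionA; exact: convolution_DK.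
Qed.

Lemma triangle_invK y : T (triangle_inv y) = y.
Proof.
apply/funext => n; rewrite triangleE.
rewrite (@eq_convolution _ s s _ (convolution C (fun k => r k * y k)))//.
  by rewrite convolution_DK mulrC mulKf.
by move=> k; rewrite two_term_inv /deconvolved mulrC divfK.
Qed.

Lemma deconvolved_triangle x : deconvolved (T x) =1 two_term x.
Proof.
move=> i; rewrite /deconvolved.
rewrite (@eq_convolution _ C C _ (convolution s (fun k => t k * two_term x k)))//.
  by rewrite convolution_KD mulrC mulKf.
by move=> k; rewrite triangleE mulrC divfK.
Qed.

Lemma triangleK x : triangle_inv (T x) = x.
Proof.
apply/funext; elim=> [|j IH].
  by rewrite triangle_inv0 deconvolved_triangle /two_term addr0 mulrC mulKf.
by rewrite triangle_invS IH deconvolved_triangle /two_term; field.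
Qed.

Definition triangle_inv_mx (j k : nat) : K :=
  \sum_(k <= i < j.+1) (- v) ^+ (j - i) / u ^+ (j - i).+1 * (C (i - k)%N * r k / t i).

Lemma triangle_inv_mxE y j :
  triangle_inv y j = \sum_(0 <= k < j.+1) triangle_inv_mx j k * y k.
Proof.
under [RHS]eq_bigr do rewrite mulr_suml.
rewrite -triangle_exchange; apply: eq_big_nat => i /andP[_ ij].
rewrite /deconvolved /convolution mulr_suml mulr_sumr.
by apply: eq_bigr => k _; rewrite /C; ring.
Qed.

(** The coefficients, as a functional of [y], of the [N]-th partial sum of the
    series of a row [a] applied to the sequence that the triangle maps to [y]. *)
Definition row_coef (a : nat -> K) (N k : nat) : K :=
  \sum_(k <= j < N) a j * triangle_inv_mx j k.

Lemma row_coef0 a N k : (N <= k)%N -> row_coef a N k = 0.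
Proof. by move=> Nk; rewrite /row_coef big_geq. Qed.

Lemma row_psum a N y :
  \sum_(0 <= j < N) a j * triangle_inv y j = \sum_(0 <= k < N) row_coef a N k * y k.
Proof.
under eq_bigr do rewrite triangle_inv_mxE mulr_sumr.
rewrite triangle_exchange; apply: eq_bigr => k _.
by rewrite mulr_suml; apply: eq_bigr => j _; rewrite mulrA.
Qed.

Lemma row_coef_swap a N k : row_coef a N k = r k *
  \sum_(k <= i < N) C (i - k)%N / t i * \sum_(i <= j < N) tilde_inner u v (fun=> a) 0 i j.
Proof.
rewrite /row_coef /triangle_inv_mx; under eq_bigr do rewrite mulr_sumr.
rewrite triangle_exchange mulr_sumr; apply: eq_bigr => i _.
by rewrite !mulr_sumr; apply: eq_bigr => j _; rewrite /tilde_inner; ring.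
Qed.

End triangle.

(** * The defect of the interchanged series *)

Section defect.
Context {K : numFieldType} (r s t : nat -> K) (u v : K) (A : inf_matrix K).
Hypotheses (hu : u != 0) (hv : v != 0).

Let b : K := - v / u.
Let b_neq0 : b != 0.
Proof. by rewrite mulf_neq0 ?invr_eq0// oppr_eq0. Qed.
Let C n : K := (-1) ^+ n * D_s s n.

Definition defect_col (k N : nat) : K :=
  r k * \sum_(k <= i < N) (-1) ^+ (i - k) * D_s s (i - k) / t i * b ^- i.

Definition defect_row (n N : nat) : K := tsum N (fun j => b ^+ j / u * A n j).

Lemma tilde_inner_tail n i m N : (i <= m)%N -> (m <= N)%N ->
  summable_from m (tilde_inner u v A n i) ->
  tsum m (tilde_inner u v A n i) =
  \sum_(m <= j < N) tilde_inner u v A n i j + b ^- i * defect_row n N.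
Proof.
move=> im mN mF; rewrite (tsum_tail mN mF); congr (_ + _).
have NF : summable_from N (tilde_inner u v A n i) := cvgP _ (summable_tail mN mF).
rewrite /defect_row (@tsum_scale _ N (b ^+ i) _ (fun j => b ^+ j / u * A n j) NF) ?mulKf ?expf_neq0// => j Nj.
have ij : (i <= j)%N := leq_trans im (leq_trans mN Nj).
rewrite /tilde_inner -{1}(subnK ij) exprD {1}/b expr_div_n exprS.
by field; rewrite hu expf_neq0.
Qed.

Hypothesis hdef : tilde_defined s t u v A.

(** Cutting the outer series of [tilde] at [N] and replacing every inner series
    by its partial sum up to [N] gives the coefficient [row_coef]; what is left
    over are the tails from [N] on, which are all multiples of a single one,
    since the inner terms are geometric in [i]. *)
Lemma tilde_partial n k N : (k.+2 <= N)%N ->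
  r k * (A n k / (s 0%N * t k) * u^-1
         + \sum_(k <= i < k.+2)
             (- 1) ^+ (i - k) * (D_s s (i - k)%N / t i) *
             tsum k.+1 (tilde_inner u v A n i)
         + \sum_(k.+2 <= i < N) tilde_outer s t u v A n k i)
  - row_coef r s t u v (A n) N k = defect_col k N * defect_row n N.
Proof.
move=> kN; have [h1 h2 _] := hdef n k.
have kN1 : (k.+1 <= N)%N := ltnW kN.
have inner0 i : tilde_inner u v (fun=> A n) 0 i = tilde_inner u v A n i by [].
rewrite row_coef_swap /defect_col -mulrBr -[RHS]mulrA; congr (_ * _).
rewrite mulr_suml [X in _ - X](big_cat_nat (n := k.+2))//=; last by rewrite ltnW.
rewrite [RHS](big_cat_nat (n := k.+2))//=; last by rewrite ltnW.
have outer : \sum_(k.+2 <= i < N) tilde_outer s t u v A n k i =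
    \sum_(k.+2 <= i < N) C (i - k)%N / t i *
      \sum_(i <= j < N) tilde_inner u v A n i j +
    \sum_(k.+2 <= i < N) C (i - k)%N / t i * b ^- i * defect_row n N.
  rewrite -big_split/=; apply: eq_big_nat => i /andP[ki iN].
  by rewrite /tilde_outer (tilde_inner_tail (leqnn i) (ltnW iN) (h2 i ki)) /C; ring.
have hk : (k <= k < k.+2)%N by rewrite leqnn leqW.
have hk1 : (k <= k.+1 < k.+2)%N by rewrite leqnSn leqnn.
have head : A n k / (s 0%N * t k) * u^-1 + \sum_(k <= i < k.+2)
      (- 1) ^+ (i - k) * (D_s s (i - k)%N / t i) * tsum k.+1 (tilde_inner u v A n i) =
    \sum_(k <= i < k.+2) C (i - k)%N / t i *
      \sum_(i <= j < N) tilde_inner u v A n i j +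
    \sum_(k <= i < k.+2) C (i - k)%N / t i * b ^- i * defect_row n N.
  rewrite !(big_nat_recl k.+1)// !big_nat1.
  rewrite (tilde_inner_tail (leqnSn k) kN1 (h1 k hk)).
  rewrite (tilde_inner_tail (leqnn k.+1) kN1 (h1 k.+1 hk1)).
  rewrite [X in _ = _ * X + _ + _](@big_ltn _ _ _ k)// [tilde_inner u v A n k k]/tilde_inner.
  rewrite subnn expr0 expr1 /C /= mul1r invfM; ring.
rewrite head outer; rewrite /C; ring.
Qed.

Lemma tilde_defect n k l : (fun N => row_coef r s t u v (A n) N k) @ \oo --> l ->
  (fun N => defect_col k N * defect_row n N) @ \oo --> tilde r s t u v A n k - l.
Proof.
move=> fl; have [_ _ h3] := hdef n k.
pose P x := r k * (A n k / (s 0%N * t k) * u^-1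
         + \sum_(k <= i < k.+2)
             (- 1) ^+ (i - k) * (D_s s (i - k)%N / t i) *
             tsum k.+1 (tilde_inner u v A n i) + x).
have h : (fun N => P (psum_from k.+2 (tilde_outer s t u v A n k) N) -
    row_coef r s t u v (A n) N k) @ \oo --> tilde r s t u v A n k - l.
  apply: cvgB => //; apply: cvgMl_tmp; apply: cvgD; first exact: cvg_cst.
  exact: summable_cvg.
apply: cvg_trans h; apply: near_eq_cvg; near=> N.
by apply: tilde_partial; near: N; exact: nbhs_infty_ge.
Unshelve. all: by end_near. Qed.

End defect.

(** The 2x2 minors vanish before the limit in [N] is taken. *)
Lemma cvg_product_rank1 (K : numFieldType) (g h : nat -> nat -> K) (d : nat -> nat -> K) :
  (forall n k, (fun N => g k N * h n N) @ \oo --> d n k) ->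
  exists lam mu, forall n k, d n k = lam n * mu k.
Proof.
move=> gh.
have minor n k n' k' : d n k * d n' k' = d n k' * d n' k.
  have l1 : (fun N => g k N * h n N * (g k' N * h n' N)) @ \oo --> d n k * d n' k'.
    by apply: cvgM.
  have l2 : (fun N => g k' N * h n N * (g k N * h n' N)) @ \oo --> d n k' * d n' k.
    by apply: cvgM.
  rewrite -(norm_cvg_lim l1) -(norm_cvg_lim l2).
  suff -> : (fun N => g k N * h n N * (g k' N * h n' N)) =
    (fun N => g k' N * h n N * (g k N * h n' N)) by [].
  by apply/funext => N; ring.
have [d0|] := pselect (forall n k, d n k = 0).
  by exists (fun=> 0), (fun=> 0) => n k; rewrite d0 mul0r.
move=> /existsNP[n0 /existsNP[k0 /eqP dN0]].
exists (fun n => d n k0 / d n0 k0), (d n0) => n k.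
apply: (mulIf dN0); rewrite minor; field.
exact: dN0.
Qed.

(** * Perturbations of rank one *)

Section dual_bounds.
Context {R : realType} {K : numFieldType} {abs : K -> R} {p : R}.
Hypothesis hK : scalar_field abs.
Hypothesis hp : 1 <= p.

Lemma dual_leZ (c : K) f (C : R) : dual_le abs p f C ->
  dual_le abs p (fun k => c * f k) (abs c * C).
Proof.
move=> fC m y y1; under eq_bigr do rewrite -mulrA.
by rewrite -mulr_sumr (absM hK) ler_wpM2l ?(abs_ge0 hK)// fC.
Qed.

Lemma dual_leD f g (C D : R) : dual_le abs p f C ->
  dual_le abs p g D ->
  dual_le abs p (fun k => f k + g k) (C + D).
Proof.
move=> fC gD m y y1; under eq_bigr do rewrite mulrDl.
by rewrite big_split (le_trans (abs_triangle hK _ _))// lerD ?fC ?gD.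
Qed.

Lemma dual_leB f g (C D : R) : dual_le abs p f C ->
  dual_le abs p g D ->
  dual_le abs p (fun k => f k - g k) (C + D).
Proof.
move=> fC gD m y y1; under eq_bigr do rewrite mulrBl.
by rewrite sumrB (le_trans (abs_triangle hK _ _))// (absN hK) lerD ?fC ?gD.
Qed.

Lemma dual_le_weaken f (C D : R) : C <= D -> dual_le abs p f C ->
  dual_le abs p f D.
Proof. by move=> CD fC m y y1; rewrite (le_trans (fC m y y1)). Qed.

Lemma dual_le0 f : (forall k, f k = 0) -> dual_le abs p f 0.
Proof. by move=> f0 m y _; rewrite big1 ?(abs0 hK)// => k _; rewrite f0 mul0r. Qed.

(** Along the one line spanned by [mu], coordinatewise convergence is
    convergence in norm, unless [mu] has infinite norm; but then finiteness of
    the norm forces the coefficient to be constant. *)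
Lemma rank1_dual_cvg0 (lam mu c : nat -> K) :
  (forall k, (fun n => lam n * mu k) @ \oo --> c k) ->
  (forall n, exists C, dual_le abs p (fun k => lam n * mu k - c k) C) ->
  forall d, 0 < d ->
  \forall n \near \oo, dual_le abs p (fun k => lam n * mu k - c k) d.
Proof.
move=> lmc fin d d0.
have [mu0|] := pselect (forall k, mu k = 0).
  apply: nearW => n; apply: (dual_le_weaken (ltW d0)); apply: dual_le0 => k.
  have -> : c k = 0.
    rewrite -(norm_cvg_lim (lmc k)); apply: norm_cvg_lim.
    by apply: cvg_near_cst; apply: nearW => j; rewrite mu0 mulr0.
  by rewrite mu0 mulr0 subr0.
move=> /existsNP[k0 /eqP muN0]; pose L := c k0 / mu k0.
have lamL : lam @ \oo --> L.
  have : (fun n => lam n * mu k0 / mu k0) @ \oo --> L by apply: cvgMr_tmp.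
  by under eq_fun do rewrite mulfK//.
have cE k : c k = L * mu k.
  by rewrite -(norm_cvg_lim (lmc k)); apply: norm_cvg_lim; exact: cvgMr_tmp.
have dE n : (fun k => lam n * mu k - c k) = (fun k => (lam n - L) * mu k).
  by apply/funext => k; rewrite cE mulrBl.
have [lamE|] := pselect (forall n, lam n = L).
  apply: nearW => n; apply: (dual_le_weaken (ltW d0)); apply: dual_le0 => k.
  by rewrite cE lamE subrr.
move=> /existsNP[n1 /eqP]; rewrite -subr_eq0 => lN0.
have [C hC] := fin n1; rewrite dE in hC.
have := dual_leZ (lam n1 - L)^-1 hC.
rewrite (_ : (fun k => _) = mu); last first.
  by apply/funext => k; rewrite mulKf.
set D := _ * C => muD; have D0 := dual_le_ge0 hK muD.
have D1 : 0 < D + 1 by rewrite ltr_wpDl.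
have /(abs_cvgP hK)/(_ _ (divr_gt0 d0 D1)) := lamL.
apply: filterS => n hn; rewrite dE.
apply: (dual_le_weaken _ (dual_leZ (lam n - L) muD)).
rewrite (@le_trans _ _ (d / (D + 1) * D)) ?ler_wpM2r//.
by rewrite mulrAC ler_pdivrMr// ler_pM2l// lerDl.
Qed.

Lemma lp_norm_eq1 y m : tail_le abs p y 0 1 ->
  \sum_(0 <= k < m) abs (y k) `^ p = 1 -> lp_norm abs p%:E y = 1%E.
Proof.
have p0 : 0 < p := lt_le_trans ltr01 hp.
move=> y1 ym; apply/eqP; rewrite eq_le; apply/andP; split.
  exact/(tail_le_normP hK hp).
rewrite leNgt; apply/negP => lt1; have ge0 := lp_norm_ge0 (abs := abs) p%:E y.
have fin : lp_norm abs p%:E y \is a fin_num.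
  by rewrite ge0_fin_numE// (lt_le_trans lt1)// leey.
move: lt1 ge0; rewrite -(fineK fin) lte_fin lee_fin; set c := fine _ => c1 c0.
have /(lp_norm_leP hK y p0 c0)/(_ m) : (lp_norm abs p%:E y <= c%:E)%E.
  by rewrite /c fineK.
have one_p : 1 `^ p = 1 :> R by rewrite powR1.
by rewrite ym -[leLHS]one_p (powR_le_powR hp)// leNgt c1.
Qed.

(** A vector of the unit ball is a multiple by a factor [g <= 1] of one of the
    unit sphere. *)
Lemma dual_le_unit_sphere f (C : R) : 0 <= C ->
  (forall y m, (forall k, (m <= k)%N -> y k = 0) -> tail_le abs p y 0 1 ->
    lp_norm abs p%:E y = 1%E -> abs (\sum_(0 <= k < m) f k * y k) <= C) ->
  dual_le abs p f C.
Proof.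
have p0 : 0 < p := lt_le_trans ltr01 hp.
move=> C0 fC m y y1.
set c := \sum_(0 <= k < m) abs (y k) `^ p in y1.
have c0 : 0 <= c by apply: sumr_ge0 => *; exact: powR_ge0.
have [c00|cN0] := eqVneq c 0.
  rewrite big_nat big1 ?(abs0 hK)// => k km.
  move/eqP: c00; rewrite psumr_eq0; last by move=> *; exact: powR_ge0.
  move=> /allP/(_ k); rewrite mem_index_iota => /(_ km).
  by rewrite powR_eq0 (abs_eq0 hK) => /andP[/eqP ->]; rewrite mulr0.
have cgt0 : 0 < c by rewrite lt_neqAle eq_sym cN0.
pose g := c `^ p^-1; have g0 : 0 < g by exact: powR_gt0.
have gp : g `^ p = c by rewrite /g -powRrM mulVf ?gt_eqF// powRr1.
have g1 : g <= 1 by rewrite -(powR_le_powR hp) ?ler01 ?(ltW g0)// powR1 gp.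
have [emb [_ embA _]] := abs_embedding hK.
have gN0 : emb g != 0 by rewrite fmorph_eq0 gt_eqF.
pose z k := if (k < m)%N then (emb g)^-1 * y k else 0.
have yz k : (k < m)%N -> y k = emb g * z k by move=> km; rewrite /z km mulVKf.
have z0 k : (m <= k)%N -> z k = 0 by rewrite /z leqNgt => /negbTE ->.
have zp : \sum_(0 <= k < m) abs (z k) `^ p = 1.
  have : c = g `^ p * \sum_(0 <= k < m) abs (z k) `^ p.
    rewrite mulr_sumr; apply: eq_big_nat => k /andP[_ km].
    by rewrite yz// (absM hK) embA gtr0_norm// powRM ?(abs_ge0 hK) ?ltW.
  by rewrite gp => cE; apply: (mulfI cN0); rewrite -cE mulr1.
have z1 : tail_le abs p z 0 1.
  have zE : (fun k => if (k < m)%N then z k else 0) = z.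
    by apply/funext => k; rewrite /z; case: (k < m)%N.
  by rewrite -zE; apply: (truncate_tail hK hp); rewrite zp.
rewrite (eq_big_nat _ _ (F2 := fun k => emb g * (f k * z k))); last first.
  by move=> k /andP[_ km]; rewrite yz// mulrCA.
rewrite -mulr_sumr (absM hK) embA gtr0_norm//.
rewrite (le_trans _ (fC z m z0 z1 (lp_norm_eq1 z1 zp)))//.
by rewrite ler_piMl// (abs_ge0 hK).
Qed.

End dual_bounds.

(** * Matrix transformations as functionals on l_p *)

Section factorization.
Context {R : realType} {K : numFieldType} {abs : K -> R} {p : R}.
Hypothesis hK : scalar_field abs.
Hypothesis hp : 1 <= p.
Context {r s t : nat -> K} {u v : K}.
Hypotheses (hr : forall n, r n != 0) (ht : forall n, t n != 0).
Hypotheses (hs : s 0%N != 0) (hu : u != 0).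
Context {A : inf_matrix K}.
Hypothesis hA : mx_class (lp_rst abs p r s t u v) c_space A.

Let G n y := mx_apply A (triangle_inv r s t u v y) n.

Lemma triangle_inv_lp_rst y : lp_space abs p%:E y ->
  lp_rst abs p r s t u v (triangle_inv r s t u v y).
Proof. by move=> yp; rewrite /lp_rst /= triangle_invK. Qed.

Let unit_vec (k j : nat) : K := (j == k)%:R.

Lemma unit_vec_lp k : lp_space abs p%:E (unit_vec k).
Proof.
apply: (@tail_le_lp _ _ _ _ hK hp _ k.+1 0); split=> // M.
rewrite big_nat big1 ?powR_ge0// => j /andP[kj _].
rewrite /unit_vec gtn_eqF// (abs0 hK) powR0//.
by rewrite gt_eqF// (lt_le_trans ltr01 hp).
Qed.

Lemma row_psum_cvg n y : lp_space abs p%:E y ->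
  (fun N => \sum_(0 <= k < N) row_coef r s t u v (A n) N k * y k) @ \oo --> G n y.
Proof.
move=> /triangle_inv_lp_rst /hA[/(_ n) An _].
apply: cvg_trans (summable_cvg An); apply: near_eq_cvg.
by apply: nearW => N; rewrite /psum_from row_psum.
Qed.

(** The first use of uniform boundedness is along the partial sums of the series
    of one row, the second along the rows; [l_p] having the finite vectors dense
    (as [p < oo]) then identifies the limits by their coefficients. *)
Lemma matrix_factorization : exists (f : nat -> nat -> K) (a : nat -> K)
    (l : (nat -> K) -> K) (B : R), 0 <= B /\
  [/\ forall n k, (fun N => row_coef r s t u v (A n) N k) @ \oo --> f n k,
      forall n, represents abs p (G n) (f n) B,
      forall y, lp_space abs p%:E y -> G ^~ y @ \oo --> l y,
      forall k, f ^~ k @ \oo --> a k &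
      represents abs p l a B].
Proof.
pose F n N k := row_coef r s t u v (A n) N k.
pose f n k := G n (unit_vec k).
have Ff n k : F n ^~ k @ \oo --> f n k.
  have h := @row_psum_cvg n _ (unit_vec_lp k).
  rewrite -/(f n k) in h; apply: cvg_trans h; apply: near_eq_cvg.
  near=> N; have kN : (k < N)%N by near: N; exact: nbhs_infty_gt.
  rewrite (@single_sum _ _ k)// /unit_vec ?eqxx ?mulr1//.
  by move=> j /negbTE ->; rewrite mulr0.
have Ffin n N : represents abs p
    (fun y => \sum_(0 <= k < N) F n N k * y k) (F n N) (\sum_(0 <= k < N) abs (F n N k)).
  by apply: (represents_finite hK hp) => k; exact: row_coef0.
have Gf n : exists C, represents abs p (G n) (f n) C.
  have [y yp|B B0 FB] := uniform_boundedness hK hp (Ffin n).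
    by apply: (abs_cvg_bounded hK); apply: cvgP; exact: row_psum_cvg.
  exists B; apply: (represents_lim hK hp) (Ff n) => [N|y].
    exact: (represents_sharpen hK hp (Ffin n N)).
  exact: row_psum_cvg.
have /choice[C GC] := Gf.
have Gcvg y : lp_space abs p%:E y -> cvgn (G ^~ y).
  by move=> /triangle_inv_lp_rst /hA[].
have [y yp|B B0 fB] := uniform_boundedness hK hp GC.
  by apply: (abs_cvg_bounded hK); exact: Gcvg.
have GB n := represents_sharpen hK hp (GC n) (fB n).
have Gl y : lp_space abs p%:E y -> G ^~ y @ \oo --> limn (G ^~ y) := Gcvg y.
have fa k : f ^~ k @ \oo --> limn (f ^~ k) := Gcvg _ (unit_vec_lp k).
exists f, (fun k => limn (f ^~ k)), (fun y => limn (G ^~ y)), B.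
split=> //; split=> //.
exact: (represents_lim hK hp GB Gl fa).
Unshelve. all: by end_near. Qed.

End factorization.

(** * Noncompactness in the space of convergent sequences *)

Section limit_superior.
Context {R : realType}.
Implicit Type w : nat -> \bar R.

Lemma limn_esup_le w (B : \bar R) :
  (\forall n \near \oo, w n <= B)%E -> (limn_esup w <= B)%E.
Proof.
move=> wB; apply: ge_ereal_inf.
exists (ereal_sup (w @` [set n | (w n <= B)%E])); first by exists [set n | (w n <= B)%E].
by apply: ge_ereal_sup => _ [n wn <-].
Qed.

Lemma limn_esup_lt w (B : \bar R) :
  (limn_esup w < B)%E -> \forall n \near \oo, (w n <= B)%E.
Proof.
move=> /ereal_inf_lt[_ [V FV <-]] VB; apply: filterS FV => n Vn.
by apply: (le_trans _ (ltW VB)); apply: ereal_sup_ubound; exists n.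
Qed.

End limit_superior.

Section noncompactness.
Context {R : realType} {K : numFieldType} {abs : K -> R}.
Hypothesis hK : scalar_field abs.
Implicit Type Q : set (nat -> K).

Let dist (y z : nat -> K) := sup_norm abs (y \- z).

(** A bounded set of convergent sequences all of whose members are within [e]
    of their limits from one index [m] on is, up to [e], a bounded set of
    vectors of [m] entries and a limit, and so has finite nets. *)
Lemma hausdorff_mnc_le Q (B e : R) (m : nat) : 0 <= e ->
  (forall z, Q z -> exists l, [/\ z @ \oo --> l, forall n, abs (z n) <= B &
     forall n, (m <= n)%N -> abs (z n - l) <= e]) ->
  (hausdorff_mnc c_space dist Q <= e%:E)%E.
Proof.
move=> e0 Qe; apply/lee_addgt0Pr => d0 d00; rewrite -EFinD.
pose d := d0 / 3; have dgt0 : 0 < d by rewrite divr_gt0.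
have [s hs] := totally_bounded hK B dgt0.
(* The last coordinate of a point of the net is a value for the limit. *)
pose net := {ffun 'I_m.+1 -> 'I_(size s).+1}.
pose center (c : net) (j : nat) : K := nth 0 (0 :: s) (c (inord (minn j m))).
have cardn : #|{: net}|.-1.+1 = #|{: net}|.
  by rewrite prednK// card_ffun expn_gt0 !card_ord.
apply: ereal_inf_lbound; exists (e + d0) => //; split; first by lra.
exists #|{: net}|.-1, (fun i => center (enum_val (cast_ord cardn i))), (fun=> e + 2 * d).
split=> [i|z Qz].
  split; last by rewrite /d; lra.
  apply/cvg_ex; exists (center (enum_val (cast_ord cardn i)) m).
  apply: cvg_near_cst; near=> j; rewrite /center minnn (minn_idPr _)//.
  by near: j; exact: nbhs_infty_ge.
have [l [zl zB ze]] := Qe z Qz.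
have lB : abs l <= B.
  rewrite -[l]subr0; apply: (abs_cvg_le hK zl).
  by apply: nearW => n; rewrite subr0.
pose target (i : 'I_m.+1) := if (i < m)%N then z i else l.
have /choice[c hc] : forall i : 'I_m.+1, exists k : 'I_(size s).+1,
    abs (nth 0 (0 :: s) k - target i) <= d.
  move=> i; have /hs[a sa ha] : abs (target i) <= B by rewrite /target; case: ifP.
  have h : (index a s < size s)%N by rewrite index_mem.
  exists (Ordinal (h : ((index a s).+1 < (size s).+1)%N)).
  by rewrite /= nth_index// (abs_dist hK).
exists (cast_ord (esym cardn) (enum_rank [ffun i => c i])) => //.
rewrite cast_ordKV enum_rankK; split; first exact: cvgP zl.
apply: (@le_lt_trans _ _ (e + d)%:E); last by rewrite lte_fin; lra.
apply: ge_ereal_sup => _ [j _ <-]; rewrite lee_fin /= /center ffunE.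
have := hc (inord (minn j m)); rewrite /target inordK ?ltnS ?geq_minr//.
have [jm|mj] := ltnP j m.
  by rewrite jm => h; rewrite (le_trans h)// lerDr.
rewrite ltnn => h.
rewrite (le_trans (abs_sub_triangle hK l _ _))// addrC lerD//.
by rewrite (abs_dist hK) ze.
Unshelve. all: by end_near. Qed.

(** The finitely many centres converge, so from some index on they are near
    their limits; a point of the ball about a centre has its limit within the
    radius of the limit of the centre, whence the factor two. *)
Lemma cover_near_limit Q (e : R) (n : nat) (x : 'I_n.+1 -> nat -> K) (rho : 'I_n.+1 -> R) :
  (forall i, c_space (x i) /\ rho i < e) ->
  Q `<=` \bigcup_(i in [set: 'I_n.+1]) open_ball c_space dist (x i) (rho i) ->
  \forall j \near \oo, forall z l, Q z -> z @ \oo --> l -> abs (z j - l) <= 2 * e.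
Proof.
move=> xe Qx.
have : \forall j \near \oo, forall i, abs (x i j - limn (x i)) <= 2 * (e - rho i).
  apply: filter_forall => i; have [xi ri] := xe i.
  by apply: (abs_cvgP hK _ _).1 => //; rewrite mulr_gt0// subr_gt0.
apply: filterS => j hj z l /Qx[i _ [_ zi]] zl.
have near_center k : abs (x i k - z k) <= rho i.
  by rewrite -lee_fin; apply/ltW/(le_lt_trans _ zi)/ereal_sup_ubound; exists k.
have lims : abs (limn (x i) - l) <= rho i.
  rewrite -[_ - l]subr0; apply: (abs_cvg_le hK (cvgB (xe i).1 zl)).
  by apply: nearW => k; rewrite subr0; exact: near_center.
have := abs_sub_triangle hK (x i j) (z j) l.
have := abs_sub_triangle hK (limn (x i)) (x i j) l.
by have := hj i; have := near_center j; rewrite (abs_dist hK (x i j) (z j)); lra.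
Qed.

End noncompactness.

Theorem theorem5p2 (R : realType) (K : numFieldType) (abs : K -> R)
  (hK : scalar_field abs)
  (r s t : nat -> K) (u v : K) (p : R)
  (hr : forall n, r n != 0) (ht : forall n, t n != 0) (hs : s 0%N != 0)
  (hu : u != 0) (hv : v != 0) (hp : 1 <= p)
  (A : inf_matrix K)
  (hA : mx_class (lp_rst abs p r s t u v) c_space A)
  (hdef : tilde_defined s t u v A)
  (alpha : nat -> K)
  (halpha : forall k, (fun n => tilde r s t u v A n k) @ \oo --> alpha k)
  (hrow : forall n, lp_space abs (hoelder_conjugate p%:E)
                      (fun k => tilde r s t u v A n k - alpha k)) :
  let limsup := limn_esup (fun n =>
    lp_norm abs (hoelder_conjugate p%:E)
      (fun k => tilde r s t u v A n k - alpha k)) in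
  let chi := operator_mnc (lp_rst abs p r s t u v)
               (lp_rst_norm abs p r s t u v)
               c_space (sup_norm abs) (mx_apply A) in
  ((2^-1)%:E * limsup <= chi)%E /\ (chi <= limsup)%E.
Proof.
move=> limsup chi.
have p0 : 0 < p := lt_le_trans ltr01 hp.
have [f [a [l [B [B0 [Ff Gf Gl fa lf]]]]]] := matrix_factorization hK hp hr ht hs hu hA.
pose G n y := mx_apply A (triangle_inv r s t u v y) n.
pose ta n k := tilde r s t u v A n k - alpha k.
pose b n k := f n k - a k.
have [lam [mu lm]] : exists lam mu : nat -> K,
    forall n k, tilde r s t u v A n k - f n k = lam n * mu k.
  exact: cvg_product_rank1 (fun n k => tilde_defect hu hv hdef (Ff n k)).
have bB n : dual_le abs p (b n) (B + B).
  by apply: (represents_dual_le hK hp (representsB hK (Gf n) lf)).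
have taE n k : ta n k - b n k = lam n * mu k - (alpha k - a k).
  by rewrite -lm /ta /b; ring.
have ta_fin n : exists2 C, 0 <= C & dual_le abs p (ta n) C.
  exists (fine (lp_norm abs (hoelder_conjugate p%:E) (ta n))).
    by rewrite fine_ge0// lp_norm_ge0.
  apply/(lp_dualP hK) => //; first by rewrite fine_ge0// lp_norm_ge0.
  by rewrite fineK// ge0_fin_numE ?lp_norm_ge0//; exact: hrow.
(* Passing between [tilde] and the coefficients [f] costs nothing in the limit
   superior. *)
have close d : 0 < d -> \forall n \near \oo,
    dual_le abs p (fun k => ta n k - b n k) d.
  move=> d0.
  have dE n : (fun k => ta n k - b n k) = (fun k => lam n * mu k - (alpha k - a k)).
    by apply/funext => k; rewrite taE.
  have cvg_dE k : (fun n => lam n * mu k) @ \oo --> alpha k - a k.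
    by under eq_fun do rewrite -lm; apply: cvgB; [exact: halpha|exact: fa].
  have fin n : exists C, dual_le abs p (fun k => lam n * mu k - (alpha k - a k)) C.
    by have [C _ hC] := ta_fin n; exists (C + (B + B)); rewrite -dE; exact: dual_leB.
  by apply: filterS (rank1_dual_cvg0 hK cvg_dE fin d0) => n; rewrite dE.
pose S := mx_apply A @` [set x | lp_rst abs p r s t u v x /\
  lp_rst_norm abs p r s t u v x = 1%E].
have limsup0 : (0 <= limsup)%E.
  apply: le_ereal_inf_tmp => _ [V FV <-]; have [n Vn] := filter_ex FV.
  apply: (@le_trans _ _ (lp_norm abs (hoelder_conjugate p%:E) (ta n))).
    exact: lp_norm_ge0.
  by apply: ereal_sup_ubound; exists n.
split.
- apply: le_ereal_inf_tmp => _ [e [e0 [n [x [rho [xe Sx]]]]] <-].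
  have be : \forall j \near \oo, dual_le abs p (b j) (2 * e).
    apply: filterS (cover_near_limit hK xe Sx) => j hj.
    apply: (dual_le_unit_sphere hK hp); first by rewrite mulr_ge0// ltW.
    move=> y m y0 y1 ny; have yp := tail_le_lp hK hp y1.
    have Sy : S (mx_apply A (triangle_inv r s t u v y)).
      exists (triangle_inv r s t u v y) => //.
      by rewrite /lp_rst_norm /lp_rst /= triangle_invK.
    have := hj _ _ Sy (Gl _ yp).
    rewrite (represents_truncated hK hp (Gf j) y0) (represents_truncated hK hp lf y0).
    by rewrite -sumrB; under eq_bigr do rewrite -mulrBl.
  have : (limsup <= (2 * e)%:E)%E.
    apply/lee_addgt0Pr => d d0; rewrite -EFinD; apply: limn_esup_le.
    apply: filterS2 be (close d d0) => j bj cj.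
    apply/(lp_dualP hK) => //; first by rewrite addr_ge0 ?mulr_ge0 ?ltW.
    have := dual_leD hK bj cj; congr dual_le.
    by apply/funext => k; rewrite addrC subrK.
  move=> h; apply: (le_trans (lee_wpmul2l _ h)); first by rewrite lee_fin invr_ge0.
  by rewrite -EFinM lee_fin mulrA mulVf// mul1r.
- have [->|] := eqVneq limsup +oo%E; first exact: leey.
  move=> limfin; have limE : limsup = (fine limsup)%:E.
    by rewrite fineK// ge0_fin_numE// ltey.
  apply/lee_addgt0Pr => d d0; rewrite limE -EFinD.
  have d2 : 0 < d / 2 by rewrite divr_gt0.
  set e := fine limsup.
  have e0 : 0 <= e by rewrite fine_ge0.
  have : (limsup < (e + d / 2)%:E)%E by rewrite limE lte_fin ltrDl.
  move=> /limn_esup_lt le; have [m _ hm] := filterI le (close _ d2).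
  apply: (hausdorff_mnc_le hK (B := B) (m := m)); first by rewrite addr_ge0// ltW.
  move=> _ [x [xp x1] <-].
  pose y := mx_apply (mx_mul (A_rst r s t) (B_uv u v)) x.
  have xE : x = triangle_inv r s t u v y by rewrite triangleK.
  have y1 : tail_le abs p y 0 1.
    by apply/(tail_le_normP hK hp) => //; rewrite -[lp_norm _ _ _]/(lp_rst_norm abs p r s t u v x) x1.
  exists (l y); split; first by rewrite xE; exact: Gl.
    by move=> n; have := Gf n _ _ _ y1; rewrite big_geq// subr0 mulr1 -xE.
  move=> n /hm[ln cn]; have bn : dual_le abs p (b n) (e + d).
    have tn : dual_le abs p (ta n) (e + d / 2).
      by apply/(lp_dualP hK) => //; rewrite addr_ge0// ltW.
    have := dual_leB hK tn cn; rewrite -addrA -splitr; congr dual_le.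
    by apply/funext => k; rewrite subKr.
  have := represents_sharpen hK hp (representsB hK (Gf n) lf) bn y1.
  by rewrite big_geq// subr0 mulr1 -xE.
Qed.
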